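(* Let $\mathcal I=(G,S,F,k)$ be a path restricted instance of \textsc{Annotated MMFVS} and let $g$ be its number of good vertices. There is an algorithm running in time $O(3^{k-g} n^{O(1)})$ which either returns a minimal feedback vertex set $S'\subseteq S\cup U$ of $G$ of size at least $k$ or correctly concludes that $\mathcal I$ is a No instance of \textsc{Annotated MMFVS}.
   Context: A feedback vertex set of $G$ is a vertex set whose removal leaves a forest; it is minimal if no proper subset is a feedback vertex set. \textsc{Annotated MMFVS}: given a graph $G=(V,E)$ with $n$ vertices, disjoint sets $S,F\subseteq V$ such that $S\cup F$ is a feedback vertex set of $G$, and an integer $k$, decide whether there is a minimal feedback vertex set $S'$ of $G$ with $|S'|\ge k$, $S'\supseteq S$ and $S'\cap F=\emptyset$. Let $U=V\setminus(S\cup F)$. For $u\in V$ and $X\subseteq V$, $\deg_X(u)$ denotes the degree of $u$ in $G[X\cup\{u\}]$. The good vertices are the elements of $H=\{s\in S:\deg_F(s)\ge 2\text{ and }\deg_U(s)\le 1\}$. An interesting path of $G[U]$ is a connected component of $G[U]$ all of whose vertices $u$ satisfy $\deg_{F\cup U}(u)=2$. An instance is path restricted if every connected component of $G[U]$ is an interesting path.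
   Formalization: The factor 3^{k-g} is read as 3^{max(k-g,0)}, since for k<g the literal bound can fall below one step; n^{O(1)} is written (n+1)^c so that the empty graph is covered. *)

(* Defs.v *)
From HB Require Import structures.
From mathcomp Require Import all_boot all_order all_algebra.

Set Implicit Arguments.
Unset Strict Implicit.
Unset Printing Implicit Defensive.

Record sgraph (n : nat) := SGraph {
  adj :> rel 'I_n;
  adj_sym : symmetric adj;
  adj_irr : irreflexive adj }.

(* G[X] has no cycle; the bound 3 discards the degenerate closed walk x, y, x *)
(* that [cycle] accepts.                                                      *)
Definition forest n (G : sgraph n) (X : {set 'I_n}) : Prop :=
  ~ exists c : seq 'I_n,
      [/\ 3 <= size c, uniq c, {subset c <= X} & cycle (adj G) c].

Definition is_fvs n (G : sgraph n) (X : {set 'I_n}) : Prop := forest G (~: X).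

Definition minimal_fvs n (G : sgraph n) (X : {set 'I_n}) : Prop :=
  is_fvs G X /\ forall Y : {set 'I_n}, Y \proper X -> ~ is_fvs G Y.

Definition deg n (G : sgraph n) (X : {set 'I_n}) (u : 'I_n) : nat :=
  #|[set v in u |: X | adj G u v]|.

Definition induced n (G : sgraph n) (X : {set 'I_n}) : rel 'I_n :=
  [rel x y | [&& x \in X, y \in X & adj G x y]].

Definition is_component n (G : sgraph n) (X C : {set 'I_n}) : Prop :=
  exists2 x, x \in X & C = [set y in X | connect (induced G X) x y].

Record instance (n : nat) := Instance {
  gr : sgraph n;
  inS : {set 'I_n};
  inF : {set 'I_n};
  par : int;
  SF_disjoint : [disjoint inS & inF];
  SF_fvs : is_fvs gr (inS :|: inF) }.

Definition inU n (I : instance n) : {set 'I_n} := ~: (inS I :|: inF I).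

Definition at_least n (A : {set 'I_n}) (k : int) : Prop := (k <= #|A|%:Z)%R.

Definition yes_instance n (I : instance n) : Prop :=
  exists S' : {set 'I_n},
    [/\ minimal_fvs (gr I) S', at_least S' (par I),
        inS I \subset S' & [disjoint S' & inF I]].

Definition good n (I : instance n) : {set 'I_n} :=
  [set s in inS I | (2 <= deg (gr I) (inF I) s) && (deg (gr I) (inU I) s <= 1)].

Definition interesting_path n (I : instance n) (C : {set 'I_n}) : Prop :=
  is_component (gr I) (inU I) C /\
  forall u, u \in C -> deg (gr I) (inF I :|: inU I) u = 2.

Definition path_restricted n (I : instance n) : Prop :=
  forall C, is_component (gr I) (inU I) C -> interesting_path I C.

(* k - g, replaced by 0 when it is negative: no algorithm can run in fewer    *)
(* than one step, whereas 3 ^ (k - g) can be smaller than any n ^ -c.         *)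
Definition excess n (I : instance n) : nat :=
  `|Num.max 0%R (par I - #|good I|%:Z)%R|%N.

(* [None] is the conclusion that I is a No instance. *)
Definition correct_answer n (I : instance n) (r : option {set 'I_n}) : Prop :=
  if r is Some S' then
    [/\ minimal_fvs (gr I) S', S' \subset inS I :|: inU I
      & at_least S' (par I)]
  else ~ yes_instance I.

(* An algorithm is a program of N. D. Jones's WHILE language over binary      *)
(* trees. Each operation is a constant number of pointer operations (there is *)
(* no equality test on trees other than the test for [Leaf]), hence takes     *)
(* constant time on a RAM.                                                    *)
Inductive tree := Leaf | Node of tree & tree.

Definition hd_tree t := if t is Node l _ then l else Leaf.
Definition tl_tree t := if t is Node _ r then r else Leaf.
Definition is_node t := if t is Node _ _ then true else false.

Inductive expr :=
  | EVar of nat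
  | ENil
  | ECons of expr & expr
  | EHd of expr
  | ETl of expr.

Inductive cmd :=
  | CAssign of nat & expr
  | CSeq of cmd & cmd
  | CIf of expr & cmd & cmd
  | CWhile of expr & cmd.

Definition store := nat -> tree.

Definition update (s : store) (x : nat) (v : tree) : store :=
  fun y => if y == x then v else s y.

Fixpoint eval (s : store) (e : expr) : tree :=
  match e with
  | EVar x => s x
  | ENil => Leaf
  | ECons e1 e2 => Node (eval s e1) (eval s e2)
  | EHd e1 => hd_tree (eval s e1)
  | ETl e1 => tl_tree (eval s e1)
  end.

Fixpoint ecost (e : expr) : nat :=
  match e with
  | EVar _ | ENil => 1
  | ECons e1 e2 => (ecost e1 + ecost e2).+1
  | EHd e1 | ETl e1 => (ecost e1).+1
  end.

(* [exec c s t s']: from store s, the command c halts after t time units in   *)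
(* store s'.                                                                  *)
Inductive exec : cmd -> store -> nat -> store -> Prop :=
  | ExAssign x e s :
      exec (CAssign x e) s (ecost e).+1 (update s x (eval s e))
  | ExSeq c1 c2 s s1 s2 t1 t2 :
      exec c1 s t1 s1 -> exec c2 s1 t2 s2 ->
      exec (CSeq c1 c2) s (t1 + t2) s2
  | ExIfT e c1 c2 s s1 t :
      is_node (eval s e) -> exec c1 s t s1 ->
      exec (CIf e c1 c2) s (ecost e + t).+1 s1
  | ExIfF e c1 c2 s s1 t :
      ~~ is_node (eval s e) -> exec c2 s t s1 ->
      exec (CIf e c1 c2) s (ecost e + t).+1 s1
  | ExWhileT e c s s1 s2 t1 t2 :
      is_node (eval s e) -> exec c s t1 s1 -> exec (CWhile e c) s1 t2 s2 ->
      exec (CWhile e c) s (ecost e + t1 + t2).+1 s2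
  | ExWhileF e c s :
      ~~ is_node (eval s e) -> exec (CWhile e c) s (ecost e).+1 s.

Lemma exec_det c s t s1 t' s2 :
  exec c s t s1 -> exec c s t' s2 -> t = t' /\ s1 = s2.
Proof.
move=> H; elim: H t' s2 => {c s t s1}
  [x e s|c1 c2 s s1 s2 t1 t2 _ IH1 _ IH2|e c1 c2 s s1 t b _ IH
  |e c1 c2 s s1 t b _ IH|e c s s1 s2 t1 t2 b _ IH1 _ IH2|e c s b] t' s' H;
  inversion H as [|? ? ? ? ? ? ? E1 E2|? ? ? ? ? ? b' E|? ? ? ? ? ? b' E
    |? ? ? ? ? ? ? b' E1 E2|? ? ? b']; subst => //.
- by have [? ?] := IH1 _ _ E1; subst; have [? ?] := IH2 _ _ E2; subst.
- by have [? ?] := IH _ _ E; subst.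
- by rewrite b in b'.
- by rewrite b' in b.
- by have [? ?] := IH _ _ E; subst.
- by have [? ?] := IH1 _ _ E1; subst; have [? ?] := IH2 _ _ E2; subst.
- by rewrite b in b'.
- by rewrite b' in b.
Qed.

(* Input and output are passed in variable 0; all other variables start as    *)
(* [Leaf].                                                                    *)
Definition computes_in (p : cmd) (input : tree) (t : nat) (output : tree) : Prop :=
  exists2 s, exec p (update (fun=> Leaf) 0 input) t s & s 0 = output.

Definition enc_bool (b : bool) : tree := if b then Node Leaf Leaf else Leaf.

Definition enc_seq (s : seq tree) : tree := foldr Node Leaf s.

Definition enc_nat (m : nat) : tree := enc_seq (nseq m Leaf).

(* Unary magnitude: running times are measured in n, k and g, not in the      *)
(* length of the input.                                                       *)
Definition enc_int (z : int) : tree := Node (enc_bool (z < 0)%R) (enc_nat `|z|%N).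

Definition enc_set n (A : {set 'I_n}) : tree :=
  enc_seq [seq enc_bool (i \in A) | i <- enum 'I_n].

Definition enc_graph n (G : sgraph n) : tree :=
  enc_seq [seq enc_seq [seq enc_bool (adj G i j) | j <- enum 'I_n]
          | i <- enum 'I_n].

Definition enc_instance n (I : instance n) : tree :=
  Node (enc_graph (gr I))
    (Node (enc_set (inS I)) (Node (enc_set (inF I)) (enc_int (par I)))).

Definition enc_answer n (r : option {set 'I_n}) : tree :=
  if r is Some A then Node Leaf (enc_set A) else Leaf.

(* Main.v *)
Require Import Defs.
From mathcomp Require Import all_boot all_order all_algebra.
From mathcomp Require Import zify.

(** Put B = F ∪ U. A solution is the complement of a maximal induced forest T with
    F ⊆ T ⊆ B. All vertices of U have degree 2 in G[B], so an exchange argument shows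
    that all maximal forests between F and B have the same size, and each of them
    links the same vertices as B does. Hence a vertex s of S stays outside a forest
    as soon as two of its neighbours that are linked in G[B] belong to it.

    The search keeps a set Z of vertices to be kept and a set D of vertices to be
    deleted, and extends F, then Z, then U greedily to a forest; for a correct guess
    the complement has at least |sat Z| + |D| vertices, where sat Z is the set of the
    s in S with two neighbours in F ∪ Z linked in G[B]. If this is less than k, take s
    outside sat Z with linked neighbours x, y not in D, and branch: delete x, delete
    y, or keep both. Each branch increases |sat Z| + |D|. Starting from the set Z of
    vertices that no solution deletes, every good vertex is in sat Z, so k - g levels
    suffice.

    All tests inside a node of the search tree are first-order formulas with bounded
    iteration over vertex sets; such formulas compile to programs of polynomial cost. *)

Set Implicit Arguments.
Unset Strict Implicit.
Unset Printing Implicit Defensive.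

(** * Execution of programs with cost bounds *)

(** The base [n.+2] is at least 2 even for [n = 0], so constant factors and sums are absorbed by the
    exponent alone. *)
Definition poly_bounded (f : nat -> nat) := exists K, forall n, f n <= n.+2 ^ K.

Lemma poly_bounded_const a : poly_bounded (fun=> a).
Proof. by exists a => n; rewrite ltnW // ltn_expl. Qed.

Lemma poly_bounded_id : poly_bounded id.
Proof. by exists 1 => n; rewrite expn1 ltnW // ltnW. Qed.

Lemma poly_bounded_add f g :
  poly_bounded f -> poly_bounded g -> poly_bounded (fun n => f n + g n).
Proof.
move=> [K Hf] [L Hg]; exists (K + L).+1 => n.
apply: (@leq_trans (2 * n.+2 ^ (K + L))); last by rewrite expnS leq_mul2r orbT.
rewrite mul2n -addnn; apply: leq_add; [apply: leq_trans (Hf n) _|apply: leq_trans (Hg n) _];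
  by rewrite leq_pexp2l // ?leq_addr ?leq_addl.
Qed.

Lemma poly_bounded_mul f g :
  poly_bounded f -> poly_bounded g -> poly_bounded (fun n => f n * g n).
Proof.
by move=> [K Hf] [L Hg]; exists (K + L) => n; rewrite expnD leq_mul.
Qed.

(** A total-correctness Hoare triple with a time bound; the lemmas below are its proof rules. *)
Definition runs (c : cmd) (s : store) (b : nat) (P : store -> Prop) :=
  exists t s', [/\ exec c s t s', t <= b & P s'].

Lemma runs_weaken c s b b' (P P' : store -> Prop) :
  runs c s b P -> b <= b' -> (forall s', P s' -> P' s') -> runs c s b' P'.
Proof.
move=> [t [s' [ex le p]]] bb PP; exists t, s'; split=> //; last exact: PP.
exact: leq_trans bb.
Qed.

Lemma runs_assign x e s b (P : store -> Prop) :
  (ecost e).+1 <= b -> P (update s x (eval s e)) -> runs (CAssign x e) s b P.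
Proof.
by move=> le p; exists (ecost e).+1, (update s x (eval s e)); split=> //; constructor.
Qed.

Lemma runs_seq c1 c2 s b b1 b2 (Q P : store -> Prop) :
  runs c1 s b1 Q -> (forall s1, Q s1 -> runs c2 s1 b2 P) -> b1 + b2 <= b ->
  runs (CSeq c1 c2) s b P.
Proof.
move=> [t1 [s1 [e1 l1 q]]] H le; have [t2 [s2 [e2 l2 p]]] := H _ q.
exists (t1 + t2), s2; split=> //; first exact: ExSeq e1 e2.
by apply: leq_trans le; exact: leq_add.
Qed.

Lemma runs_if e c1 c2 s b b' (P : store -> Prop) :
  (if is_node (eval s e) then runs c1 s b P else runs c2 s b P) ->
  ecost e + b < b' -> runs (CIf e c1 c2) s b' P.
Proof.
case: ifP => E [t [s' [ex l p]]] le; exists (ecost e + t).+1, s'.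
  by split=> //; [exact: ExIfT | lia].
by split=> //; [apply: ExIfF; rewrite ?E | lia].
Qed.

Lemma runs_while_end e c s b (P : store -> Prop) :
  is_node (eval s e) = false -> (ecost e).+1 <= b -> P s -> runs (CWhile e c) s b P.
Proof. by move=> E le p; exists (ecost e).+1, s; split=> //; apply: ExWhileF; rewrite E. Qed.

Lemma runs_while_step e c s b b1 b2 (Q P : store -> Prop) :
  is_node (eval s e) -> runs c s b1 Q ->
  (forall s1, Q s1 -> runs (CWhile e c) s1 b2 P) -> ecost e + b1 + b2 < b ->
  runs (CWhile e c) s b P.
Proof.
move=> E [t1 [s1 [e1 l1 q]]] H le; have [t2 [s2 [e2 l2 p]]] := H _ q.
exists (ecost e + t1 + t2).+1, s2; split=> //; first exact: ExWhileT e1 e2.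
by lia.
Qed.

Lemma enc_nat_node m : is_node (enc_nat m) = (0 < m).
Proof. by case: m. Qed.

Lemma enc_seq_node l : is_node (enc_seq l) = (0 < size l).
Proof. by case: l. Qed.

Lemma tl_enc_nat m : tl_tree (enc_nat m) = enc_nat m.-1.
Proof. by case: m. Qed.

Lemma tl_enc_seq l : tl_tree (enc_seq l) = enc_seq (behead l).
Proof. by case: l. Qed.

Lemma hd_enc_seq l : hd_tree (enc_seq l) = head Leaf l.
Proof. by case: l. Qed.

Lemma is_node_bool b : is_node (enc_bool b) = b.
Proof. by case: b. Qed.

Lemma update_eq s x v : update s x v x = v.
Proof. by rewrite /update eqxx. Qed.

Lemma update_lt s x v y : y < x -> update s x v y = s y.
Proof. by rewrite /update => /ltn_eqF->. Qed.

Lemma update_gt s x v y : x < y -> update s x v y = s y.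
Proof. by rewrite /update => /gtn_eqF->. Qed.

(* The scratch variables are numbered from [d] on: commands leave their result *)
(* in variable [d] and do not touch the variables below it.                    *)
Definition keeps d (s s' : store) := forall j, j < d -> s' j = s j.

Lemma keeps_trans d s1 s2 s3 : keeps d s1 s2 -> keeps d s2 s3 -> keeps d s1 s3.
Proof. by move=> h1 h2 j jd; rewrite h2 // h1. Qed.

Lemma keeps_le d d' s s' : d <= d' -> keeps d' s s' -> keeps d s s'.
Proof. by move=> le h j jd; apply: h; exact: leq_trans le. Qed.

Lemma keeps_update d s x v : d <= x -> keeps d s (update s x v).
Proof. by move=> dx j jd; rewrite update_lt //; exact: leq_trans dx. Qed.

(** Array access in unary: variable [d.+1] counts down a copy of [x] while heads are dropped from
    [d]. On a list this brings the entry with index [x] to the head; on a unary number it is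
    truncated subtraction. *)
Definition walk x d :=
  CSeq (CAssign d.+1 (EVar x))
       (CWhile (EVar d.+1) (CSeq (CAssign d.+1 (ETl (EVar d.+1)))
                                 (CAssign d (ETl (EVar d))))).

Definition walk_cost m := 10 * m + 10.

Lemma runs_walk x d s m : x < d -> s x = enc_nat m ->
  runs (walk x d) s (walk_cost m)
    (fun s' => s' d = iter m tl_tree (s d) /\ keeps d s s').
Proof.
move=> xd sx; apply: (@runs_seq _ _ _ _ 2 (10 * m + 8)
  (fun s' => [/\ s' d.+1 = enc_nat m, s' d = s d & keeps d s s'])).
- apply: runs_assign => //; split; first by rewrite update_eq.
    by rewrite update_lt.
  exact: keeps_update.
- move=> s1 [s1d s1e k1]; rewrite -s1e => {sx}.
  suff: runs (CWhile (EVar d.+1) (CSeq (CAssign d.+1 (ETl (EVar d.+1)))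
                                 (CAssign d (ETl (EVar d))))) s1 (10 * m + 8)
    (fun s' => s' d = iter m tl_tree (s1 d) /\ keeps d s1 s').
    move=> H; apply: runs_weaken H _ _ => // s' [-> k2]; split=> //.
    exact: keeps_trans k2.
  elim: m s1 s1d {s1e k1} => [|m IH] s1 s1d.
    by apply: runs_while_end; rewrite //= s1d.
  apply: (@runs_while_step _ _ _ _ 6 (10 * m + 8) (fun s' => [/\ s' d.+1 = enc_nat m,
     s' d = tl_tree (s1 d) & keeps d s1 s'])).
  + by rewrite /= s1d.
  + apply: (@runs_seq _ _ _ _ 3 3 (fun s' => s' = update s1 d.+1 (enc_nat m))) => //.
      by apply: runs_assign => //=; rewrite s1d.
    move=> _ ->; apply: runs_assign => //=.
    rewrite update_gt // update_eq update_eq update_lt //; split=> //.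
    apply: keeps_trans (keeps_update _ _ _) (keeps_update _ _ _) => //.
  + move=> s2 [h1 h2 h3]; apply: runs_weaken (IH _ h1) _ _ => // s' [-> k].
    by rewrite h2 -iterSr; split=> //; exact: keeps_trans k.
  + rewrite /=; lia.
- rewrite /walk_cost; lia.
Qed.

Lemma iter_tl_enc_seq m l : iter m tl_tree (enc_seq l) = enc_seq (drop m l).
Proof.
elim: m l => [|m IH] l; first by rewrite drop0.
by rewrite iterSr tl_enc_seq IH; case: l.
Qed.

Lemma iter_tl_enc_nat m k : iter m tl_tree (enc_nat k) = enc_nat (k - m).
Proof.
rewrite /enc_nat iter_tl_enc_seq; congr enc_seq.
by elim: m k => [|m IH] [|k] //=; rewrite ?IH // drop0.
Qed.

Lemma hd_drop m l : hd_tree (enc_seq (drop m l)) = nth Leaf l m.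
Proof. by rewrite hd_enc_seq -nth0 nth_drop addn0. Qed.

(* Variable 1 holds the adjacency matrix, whose rows serve as loop counter; the *)
(* current vertex is kept in unary in variable [d.+2].                         *)
Definition for_all d body :=
  CSeq (CAssign d.+1 (EVar 1)) (CSeq (CAssign d.+2 ENil)
    (CWhile (EVar d.+1) (CSeq body
       (CSeq (CAssign d.+2 (ECons ENil (EVar d.+2)))
             (CAssign d.+1 (ETl (EVar d.+1))))))).

Definition for_cost n b := n * (b + 12) + 12.

Section Loop.
Variables (n : nat) (G : sgraph n) (A : Type) (enc : A -> tree).

Lemma runs_for d body b (step : A -> 'I_n -> A) a0 s :
  1 < d -> s 1 = enc_graph G -> s d = enc a0 ->
  (forall a (i : 'I_n) s1, keeps d s s1 -> s1 d = enc a -> s1 d.+2 = enc_nat i ->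
     runs body s1 b (fun s2 =>
       [/\ s2 d = enc (step a i), keeps d s1 s2,
           s2 d.+1 = s1 d.+1 & s2 d.+2 = s1 d.+2])) ->
  runs (for_all d body) s (for_cost n b)
    (fun s' => s' d = enc (foldl step a0 (enum 'I_n)) /\ keeps d s s').
Proof.
move=> d1 s_1 s_d Hb.
pose Inv (a : A) (m : nat) (l : seq tree) (s1 : store) :=
  [/\ s1 d = enc a, keeps d s s1, s1 d.+1 = enc_seq l & s1 d.+2 = enc_nat m].
(* [r] is the list of vertices still to be visited. Its values are consecutive from the counter [m],
   so the unary number in [d.+2] always encodes the current vertex. *)
have loop (r : seq 'I_n) a m l s1 : Inv a m l s1 -> size l = size r ->
   [seq val i | i <- r] = iota m (size r) ->
   runs (CWhile (EVar d.+1) (CSeq body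
       (CSeq (CAssign d.+2 (ECons ENil (EVar d.+2)))
             (CAssign d.+1 (ETl (EVar d.+1)))))) s1 (size r * (b + 12) + 2)
    (fun s' => s' d = enc (foldl step a r) /\ keeps d s s').
  elim: r a m l s1 => [|i r IH] a m l s1 [h1 h2 h3 h4] sl.
    by move=> _; case: l sl h3 => // _ h3; apply: runs_while_end; rewrite //= h3.
  case: l sl h3 => // c l [sl] h3 [im er].
  apply: (@runs_while_step _ _ _ _ (b + 8) (size r * (b + 12) + 2)
     (Inv (step a i) m.+1 l)).
  - by rewrite /= h3.
  - apply: (@runs_seq _ _ _ _ b 8 (Inv (step a i) m (c :: l))) => //.
      apply: runs_weaken (Hb a i s1 h2 h1 _) _ _ => //; first by rewrite im.
      move=> s2 [g1 g2 g3 g4]; split=> //; rewrite ?g3 ?g4 //.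
      exact: keeps_trans g2.
    move=> s2 [g1 g2 g3 g4].
    apply: (@runs_seq _ _ _ _ 4 3 (Inv (step a i) m.+1 (c :: l))) => //.
      apply: runs_assign => //=; split.
      + by rewrite update_lt.
      + by apply: keeps_trans g2 (keeps_update _ _ _); rewrite // ltnW.
      + by rewrite update_lt.
      + by rewrite update_eq g4.
    move=> s3 [k1 k2 k3 k4]; apply: runs_assign => //=; split.
    + by rewrite update_lt.
    + by apply: keeps_trans k2 (keeps_update _ _ _).
    + by rewrite update_eq k3.
    + by rewrite update_gt.
  - by move=> s2 h; apply: IH h _ _.
  - rewrite /=; lia.
apply: (@runs_seq _ _ _ _ 2 (n * (b + 12) + 8)
   (fun s1 => [/\ s1 d = enc a0, keeps d s s1 & s1 d.+1 = enc_graph G])).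
- apply: runs_assign => //=; rewrite update_eq update_lt //; split=> //.
  exact: keeps_update.
- move=> s1 [h1 h2 h3].
  apply: (@runs_seq _ _ _ _ 2 (n * (b + 12) + 2)
   (Inv a0 0 [seq enc_seq [seq enc_bool (adj G i j) | j <- enum 'I_n] | i <- enum 'I_n])).
  + apply: runs_assign => //=; split; rewrite ?update_eq // ?update_lt //.
    by apply: keeps_trans h2 (keeps_update _ _ _); rewrite // ltnW.
  + move=> s2 h; have := loop (enum 'I_n) _ _ _ _ h.
    by rewrite size_map size_enum_ord val_enum_ord; apply.
  + lia.
- rewrite /for_cost; lia.
Qed.
End Loop.

(** * A first-order language and its compilation *)

Definition upd T (f : nat -> T) x v := fun y => if y == x then v else f y.

(* Terms of sort [true] are formulas, terms of sort [false] denote vertex sets. *)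
Inductive tm : bool -> Type :=
  | TVar of nat : tm false
  | TComp of nat & tm true : tm false
  | TFold of nat & nat & tm false & tm false : tm false
  | TMem of nat & tm false : tm true
  | TAdj of nat & nat : tm true
  | TLt of nat & nat : tm true
  | TAnd of tm true & tm true : tm true
  | TNot of tm true : tm true
  | TEx of nat & tm true : tm true.

Definition value n (b : bool) : Type := if b then (bool : Type) else {set 'I_n}.

(** [TFold] rebinds the set variable to the value accumulated so far. This bounded iteration is what
    makes reachability and greedy extension expressible. *)
Fixpoint sem n (G : sgraph n) (M : nat -> {set 'I_n}) (V : nat -> 'I_n) b (t : tm b) : value n b :=
  match t in tm b return value n b with
  | TVar X => M X
  | TComp v f => [set i | sem G M (upd V v i) f]
  | TFold X v e0 e1 =>
      foldl (fun R i => sem G (upd M X R) (upd V v i) e1) (sem G M V e0) (enum 'I_n)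
  | TMem v e => V v \in (sem G M V e : {set 'I_n})
  | TAdj v w => adj G (V v) (V w)
  | TLt v w => V v < V w
  | TAnd f g => sem G M V f && sem G M V g
  | TNot f => ~~ sem G M V f
  | TEx v f => [exists i, sem G M (upd V v i) f]
  end.

Definition enc_val n b : value n b -> tree :=
  if b is true return value n b -> tree then enc_bool else @enc_set n.

(** A comprehension is built by prepending one bit per vertex, hence in reverse order; this restores
    the order of [enc_set]. *)
Definition reverse d :=
  CSeq (CAssign d.+1 (EVar d)) (CSeq (CAssign d ENil)
    (CWhile (EVar d.+1) (CSeq (CAssign d (ECons (EHd (EVar d.+1)) (EVar d)))
                              (CAssign d.+1 (ETl (EVar d.+1)))))).

(** [rs] and [rv] say where the set and vertex variables are stored. A loop occupies [d], [d.+1] and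
    [d.+2] (accumulator, row counter, current vertex), so its body is compiled at [d.+3]. *)
Fixpoint compile (rs rv : nat -> nat) d b (t : tm b) : cmd :=
  match t with
  | TVar X => CAssign d (EVar (rs X))
  | TComp v f =>
      CSeq (CAssign d ENil)
        (CSeq (for_all d (CSeq (compile rs (upd rv v d.+2) d.+3 f)
                               (CAssign d (ECons (EVar d.+3) (EVar d)))))
              (reverse d))
  | TFold X v e0 e1 =>
      CSeq (compile rs rv d e0)
        (for_all d (CSeq (compile (upd rs X d) (upd rv v d.+2) d.+3 e1)
                         (CAssign d (EVar d.+3))))
  | TMem v e => CSeq (compile rs rv d e) (CSeq (walk (rv v) d) (CAssign d (EHd (EVar d))))
  | TAdj v w =>
      CSeq (CAssign d (EVar 1)) (CSeq (walk (rv v) d) (CSeq (CAssign d (EHd (EVar d)))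
        (CSeq (walk (rv w) d) (CAssign d (EHd (EVar d))))))
  | TLt v w =>
      CSeq (CAssign d (EVar (rv w))) (CSeq (walk (rv v) d)
        (CIf (EVar d) (CAssign d (ECons ENil ENil)) (CAssign d ENil)))
  | TAnd f g =>
      CSeq (compile rs rv d f) (CIf (EVar d) (compile rs rv d g) (CAssign d ENil))
  | TNot f =>
      CSeq (compile rs rv d f)
           (CIf (EVar d) (CAssign d ENil) (CAssign d (ECons ENil ENil)))
  | TEx v f =>
      CSeq (CAssign d ENil)
        (for_all d (CSeq (compile rs (upd rv v d.+2) d.+3 f)
           (CIf (EVar d.+3) (CAssign d (ECons ENil ENil)) (CAssign d (EVar d)))))
  end.

Fixpoint cost b (t : tm b) n : nat :=
  match t with
  | TVar X => 2
  | TComp v f => 2 + (for_cost n (cost f n + 10) + (12 * n + 12))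
  | TFold X v e0 e1 => cost e0 n + for_cost n (cost e1 n + 10)
  | TMem v e => cost e n + (walk_cost n + 3)
  | TAdj v w => 2 + (walk_cost n + (3 + (walk_cost n + 3)))
  | TLt v w => 2 + (walk_cost n + 10)
  | TAnd f g => cost f n + (cost g n + 10)
  | TNot f => cost f n + 10
  | TEx v f => 2 + for_cost n (cost f n + 10)
  end.

Lemma poly_bounded_cost b (t : tm b) : poly_bounded (cost t).
Proof.
have pw : poly_bounded walk_cost.
  apply: poly_bounded_add; last exact: poly_bounded_const.
  by apply: poly_bounded_mul; [exact: poly_bounded_const|exact: poly_bounded_id].
have pf f : poly_bounded f -> poly_bounded (fun n => for_cost n (f n)).
  move=> Hf; apply: poly_bounded_add; last exact: poly_bounded_const.
  apply: poly_bounded_mul; first exact: poly_bounded_id.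
  by apply: poly_bounded_add Hf _; exact: poly_bounded_const.
have pa f a : poly_bounded f -> poly_bounded (fun n => f n + a).
  by move=> Hf; apply: poly_bounded_add Hf _; exact: poly_bounded_const.
have pc a f : poly_bounded f -> poly_bounded (fun n => a + f n).
  by move=> Hf; apply: poly_bounded_add Hf; exact: poly_bounded_const.
elim: t => /= *.
- exact: poly_bounded_const.
- apply: (pc); apply: poly_bounded_add; first by apply: (pf); exact: pa.
  apply: (pa); apply: poly_bounded_mul; [exact: poly_bounded_const|exact: poly_bounded_id].
- by apply: poly_bounded_add => //; apply: (pf); exact: pa.
- by apply: poly_bounded_add => //; exact: pa.
- by apply: (pc); apply: poly_bounded_add => //; apply: (pc); exact: pa.
- by apply: (pc); exact: pa.
- by apply: poly_bounded_add => //; exact: pa.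
- exact: pa.
- by apply: (pc); apply: (pf); exact: pa.
Qed.

Lemma runs_reverse d l s : s d = enc_seq l ->
  runs (reverse d) s (12 * size l + 12) (fun s' => s' d = enc_seq (rev l) /\ keeps d s s').
Proof.
move=> sd.
have loop l1 l2 s1 : keeps d s s1 -> s1 d = enc_seq l2 -> s1 d.+1 = enc_seq l1 ->
   runs (CWhile (EVar d.+1) (CSeq (CAssign d (ECons (EHd (EVar d.+1)) (EVar d)))
                              (CAssign d.+1 (ETl (EVar d.+1))))) s1 (12 * size l1 + 2)
     (fun s' => s' d = enc_seq (catrev l1 l2) /\ keeps d s s').
  elim: l1 l2 s1 => [|a l1 IH] l2 s1 k1 h1 h2.
    by apply: runs_while_end; rewrite //= h2.
  apply: (@runs_while_step _ _ _ _ 8 (12 * size l1 + 2) (fun s2 => [/\ keeps d s s2,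
     s2 d = enc_seq (a :: l2) & s2 d.+1 = enc_seq l1])).
  - by rewrite /= h2.
  - apply: (@runs_seq _ _ _ _ 5 3 (fun s2 => [/\ keeps d s s2,
     s2 d = enc_seq (a :: l2) & s2 d.+1 = enc_seq (a :: l1)])) => //.
      apply: runs_assign => //=; split.
      + exact: keeps_trans k1 (keeps_update _ _ _).
      + by rewrite update_eq h1 h2.
      + by rewrite update_gt.
    move=> s2 [k2 g1 g2]; apply: runs_assign => //=; split.
    + by apply: keeps_trans k2 (keeps_update _ _ _).
    + by rewrite update_lt.
    + by rewrite update_eq g2.
  - by move=> s2 [k2 g1 g2]; apply: IH.
  - rewrite /=; lia.
apply: (@runs_seq _ _ _ _ 2 (12 * size l + 4)
   (fun s1 => keeps d s s1 /\ s1 d.+1 = enc_seq l)); last by lia.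
  apply: runs_assign => //=; rewrite update_eq; split=> //.
  by apply: keeps_update.
move=> s1 [k1 h1]; apply: (@runs_seq _ _ _ _ 2 (12 * size l + 2)
   (fun s1 => [/\ keeps d s s1, s1 d = enc_seq [::] & s1 d.+1 = enc_seq l])); last by lia.
  apply: runs_assign => //=; rewrite update_eq update_gt //; split=> //.
  exact: keeps_trans k1 (keeps_update _ _ _).
by move=> s2 [k2 h2 h3]; exact: loop.
Qed.

(** * Correctness and cost of compiled terms *)

Definition models n (G : sgraph n) (M : nat -> {set 'I_n}) (V : nat -> 'I_n) rs rv d (s : store) :=
  [/\ 1 < d, s 1 = enc_graph G,
      forall X, rs X < d /\ s (rs X) = enc_set (M X)
    & forall v, rv v < d /\ s (rv v) = enc_nat (V v)].

Lemma models_keeps n (G : sgraph n) M V rs rv d d' s s' :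
  models G M V rs rv d s -> d <= d' -> keeps d s s' -> models G M V rs rv d' s'.
Proof.
move=> [h1 h2 h3 h4] le k; split.
- exact: leq_trans le.
- by rewrite k.
- by move=> X; have [l e] := h3 X; rewrite k // (leq_trans l).
- by move=> X; have [l e] := h4 X; rewrite k // (leq_trans l).
Qed.

Lemma models_vertex n (G : sgraph n) M V rs rv d s v x (i : 'I_n) :
  models G M V rs rv d s -> x < d -> s x = enc_nat i ->
  models G M (upd V v i) rs (upd rv v x) d s.
Proof.
by move=> [h1 h2 h3 h4] xd sx; split=> // w; rewrite /upd; case: eqP.
Qed.

Lemma models_set n (G : sgraph n) M V rs rv d s X x R :
  models G M V rs rv d s -> x < d -> s x = enc_set R ->
  models G (upd M X R) V (upd rs X x) rv d s.
Proof.
by move=> [h1 h2 h3 h4] xd sx; split=> // w; rewrite /upd; case: eqP.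
Qed.

Lemma nth_enc_bool n (P : pred 'I_n) (i : 'I_n) :
  nth Leaf [seq enc_bool (P j) | j <- enum 'I_n] i = enc_bool (P i).
Proof. by rewrite (nth_map i) ?size_enum_ord // nth_ord_enum. Qed.

Lemma foldl_or T (P : pred T) b l : foldl (fun a i => P i || a) b l = has P l || b.
Proof. by elim: l b => //= x l IH b; rewrite IH orbCA orbA. Qed.

Lemma foldl_cons T U (f : T -> U) a l :
  foldl (fun a i => f i :: a) a l = rev [seq f i | i <- l] ++ a.
Proof. by elim: l a => //= x l IH a; rewrite IH rev_cons cat_rcons. Qed.

Lemma runs_walk_ord n (i : 'I_n) x d s : x < d -> s x = enc_nat i ->
  runs (walk x d) s (walk_cost n)
    (fun s' => s' d = iter i tl_tree (s d) /\ keeps d s s').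
Proof.
move=> xd sx; apply: runs_weaken (runs_walk xd sx) _ _ => //.
by rewrite /walk_cost; have := ltn_ord i; lia.
Qed.

Lemma runs_compile n (G : sgraph n) b (t : tm b) M V rs rv d s :
  models G M V rs rv d s ->
  runs (compile rs rv d t) s (cost t n)
    (fun s' => s' d = enc_val (sem G M V t) /\ keeps d s s').
Proof.
elim: t M V rs rv d s => [X|v f IH|X v e0 IH0 e1 IH1|v e IH|v w|v w|f IHf g IHg|f IH|v f IH]
  M V rs rv d s mod /=; have [d1 s_1 HX Hv] := mod.
- apply: runs_assign => //=; rewrite update_eq; split; last exact: keeps_update.
  by have [_ ->] := HX X.
- apply: (runs_seq (b1 := 2) (b2 := for_cost n (cost f n + 10) + (12 * n + 12))
    (Q := fun s1 => s1 d = enc_seq [::] /\ keeps d s s1)) => //.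
    by apply: runs_assign => //=; rewrite update_eq; split=> //; exact: keeps_update.
  move=> s1 [h1 k1]; apply: (runs_seq (b1 := for_cost n (cost f n + 10)) (b2 := 12 * n + 12)) => //.
    apply: (runs_for (G := G) (enc := enc_seq)
      (step := fun a i => enc_bool (sem G M (upd V v i) f) :: a) d1 _ h1).
      by rewrite k1.
    move=> a i s2 k2 h2 h2'.
    have m2 : models G M (upd V v i) rs (upd rv v d.+2) d.+3 s2.
      apply: models_vertex => //.
      apply: (models_keeps mod); first by lia.
      exact: keeps_trans k2.
    apply: (runs_seq (b1 := cost f n) (b2 := 4) (IH _ _ _ _ _ _ m2)); last by lia.
    move=> s3 [h3 k3]; apply: runs_assign => //=; split.
    + by rewrite update_eq h3 k3 ?h2 //; lia.
    + apply: keeps_trans (keeps_update _ _ _) => //.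
      by apply: keeps_le k3; lia.
    + by rewrite update_gt // k3.
    + by rewrite update_gt // k3.
  move=> s2 [h2 k2]; rewrite foldl_cons cats0 in h2.
  have := runs_reverse h2; rewrite size_rev size_map size_enum_ord revK => H.
  apply: runs_weaken H _ _ => // s3 [h3 k3]; split.
    rewrite h3 /enc_set; congr enc_seq; apply: eq_map => i; by rewrite inE.
  exact: keeps_trans (keeps_trans k1 k2) k3.
- apply: (runs_seq (IH0 _ _ _ _ _ _ mod)) (leqnn _) => s1 [h1 k1].
  have := @runs_for n G _ (@enc_set n) d _ (cost e1 n + 10)
     (fun R i => sem G (upd M X R) (upd V v i) e1) (sem G M V e0) s1 d1 _ h1.
  move/(_ (CSeq (compile (upd rs X d) (upd rv v d.+2) d.+3 e1) (CAssign d (EVar d.+3)))).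
  rewrite k1 // => /(_ s_1) H.
  apply: runs_weaken (H _) (leqnn _) _; last first.
    by move=> s2 [h2 k2]; split=> //; exact: keeps_trans k2.
  move=> R i s2 k2 h2 h2'.
  have m2 : models G (upd M X R) (upd V v i) (upd rs X d) (upd rv v d.+2) d.+3 s2.
    apply: models_vertex => //; apply: models_set => //; last by lia.
    apply: (models_keeps mod); first by lia.
    exact: keeps_trans k2.
  apply: (runs_seq (b2 := 2) (IH1 _ _ _ _ _ _ m2)); last by lia.
  move=> s3 [h3 k3]; apply: runs_assign => //=; split.
  + by rewrite update_eq h3.
  + apply: keeps_trans (keeps_update _ _ _) => //.
    by apply: keeps_le k3; lia.
  + by rewrite update_gt // k3.
  + by rewrite update_gt // k3.
- apply: (runs_seq (IH _ _ _ _ _ _ mod)) (leqnn _) => s1 [h1 k1].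
  have [lv ev] := Hv v.
  apply: (runs_seq (b2 := 3) (runs_walk_ord (i := V v) lv _)) (leqnn _); first by rewrite k1.
  move=> s2 [h2 k2]; apply: runs_assign => //=; rewrite update_eq; split.
    by rewrite h2 h1 /enc_val /enc_set iter_tl_enc_seq hd_drop nth_enc_bool.
  by apply: keeps_trans (keeps_update _ _ _) => //; exact: keeps_trans k2.
- have [lv ev] := Hv v; have [lw ew] := Hv w.
  apply: (runs_seq (b1 := 2) (Q := fun s1 => s1 d = enc_graph G /\ keeps d s s1)) (leqnn _).
    by apply: runs_assign => //=; rewrite update_eq; split=> //; exact: keeps_update.
  move=> s1 [h1 k1].
  apply: (runs_seq (runs_walk_ord (i := V v) lv _)) (leqnn _); first by rewrite k1.
  move=> s2 [h2 k2].
  apply: (runs_seq (b1 := 3) (Q := fun s3 =>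
     s3 d = enc_seq [seq enc_bool (adj G (V v) j) | j <- enum 'I_n] /\ keeps d s s3)) (leqnn _).
    apply: runs_assign => //=; rewrite update_eq; split.
      rewrite h2 h1 /enc_graph iter_tl_enc_seq hd_drop.
      by rewrite (nth_map (V v)) ?size_enum_ord // nth_ord_enum.
    by apply: keeps_trans (keeps_update _ _ _) => //; exact: keeps_trans k2.
  move=> s3 [h3 k3].
  apply: (runs_seq (b2 := 3) (runs_walk_ord (i := V w) lw _)) (leqnn _); first by rewrite k3.
  move=> s4 [h4 k4]; apply: runs_assign => //=; rewrite update_eq; split.
    by rewrite h4 h3 iter_tl_enc_seq hd_drop nth_enc_bool.
  by apply: keeps_trans (keeps_update _ _ _) => //; exact: keeps_trans k4.
- have [lv ev] := Hv v; have [lw ew] := Hv w.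
  apply: (runs_seq (b1 := 2) (Q := fun s1 => s1 d = enc_nat (V w) /\ keeps d s s1)) (leqnn _).
    by apply: runs_assign => //=; rewrite update_eq; split=> //; exact: keeps_update.
  move=> s1 [h1 k1].
  apply: (runs_seq (runs_walk_ord (i := V v) lv _)) (leqnn _); first by rewrite k1.
  move=> s2 [h2 k2]; apply: (runs_if (b := 4)) => //=.
  (* The walk leaves [V w - V v] in unary, which is a node exactly when [V v < V w]. *)
  rewrite h2 h1 iter_tl_enc_nat enc_nat_node subn_gt0.
  by case: (V v < V w); apply: runs_assign => //=; rewrite update_eq; split=> //;
    apply: keeps_trans (keeps_update _ _ _) => //; exact: keeps_trans k2.
- apply: (runs_seq (IHf _ _ _ _ _ _ mod)) (leqnn _) => s1 [h1 k1].
  apply: (runs_if (b := cost g n + 2)) => /=; last by lia.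
  rewrite h1 is_node_bool; case: (sem G M V f) => /=.
    apply: runs_weaken (IHg _ _ _ _ _ _ (models_keeps mod (leqnn _) k1)) _ _; first by lia.
    by move=> s2 [-> k2]; split=> //; exact: keeps_trans k2.
  apply: runs_assign => /=; first by lia.
  by rewrite update_eq; split=> //; exact: keeps_trans (keeps_update _ _ _).
- apply: (runs_seq (IH _ _ _ _ _ _ mod)) (leqnn _) => s1 [h1 k1].
  apply: (runs_if (b := 4)) => //=.
  by rewrite h1 is_node_bool; case: (sem G M V f); apply: runs_assign => //=;
    rewrite update_eq; split=> //; exact: keeps_trans (keeps_update _ _ _).
- apply: (runs_seq (b1 := 2) (Q := fun s1 => s1 d = enc_bool false /\ keeps d s s1)) (leqnn _).
    by apply: runs_assign => //=; rewrite update_eq; split=> //; exact: keeps_update.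
  move=> s1 [h1 k1].
  have := @runs_for n G _ enc_bool d _ (cost f n + 10)
     (fun a i => sem G M (upd V v i) f || a) false s1 d1 _ h1.
  move/(_ (CSeq (compile rs (upd rv v d.+2) d.+3 f)
           (CIf (EVar d.+3) (CAssign d (ECons ENil ENil)) (CAssign d (EVar d))))).
  rewrite k1 // => /(_ s_1) H.
  apply: runs_weaken (H _) (leqnn _) _; last first.
    move=> s2 [h2 k2]; split; last exact: keeps_trans k2.
    rewrite h2 foldl_or orbF; congr enc_bool; apply/hasP/existsP => [[i _ Hi]|[i Hi]].
      by exists i.
    by exists i => //; rewrite mem_enum.
  move=> a i s2 k2 h2 h2'.
  have m2 : models G M (upd V v i) rs (upd rv v d.+2) d.+3 s2.
    apply: models_vertex => //.
    apply: (models_keeps mod); first by lia.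
    exact: keeps_trans k2.
  apply: (runs_seq (b2 := 6) (IH _ _ _ _ _ _ m2)); last by lia.
  move=> s3 [h3 k3]; have sd : s3 d = enc_bool a by rewrite k3 ?h2 //; lia.
  apply: (runs_if (b := 4)) => //=.
  rewrite h3 is_node_bool; case: (sem _ _ _ f); apply: runs_assign => //=;
   (split; [by rewrite update_eq
           | by apply: keeps_trans (keeps_update _ _ _) => //; apply: keeps_le k3; lia
           | by rewrite update_gt // k3
           | by rewrite update_gt // k3]).
Qed.

(** * Maximal induced forests *)

Section Graph.
Variables (n : nat) (G : sgraph n).
Implicit Types (A B T X Y : {set 'I_n}) (s u v w x y z : 'I_n).

Definition linked X : rel 'I_n := connect (induced G X).

(** For [s] outside a forest [T], [two_linked T T s] means that adding [s] closes a cycle.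
    Neighbours and links have separate ranges because the search takes neighbours in [F :|: Z] but
    links in the whole of [B]. *)
Definition two_linked A X s : bool :=
  [exists x, exists y,
    [&& x \in A, y \in A, x < y, adj G s x, adj G s y & linked X x y]].

Lemma induced_sym X : symmetric (induced G X).
Proof. by move=> x y; rewrite /induced /= (adj_sym G) andbCA. Qed.

Lemma linked_sym X : symmetric (linked X).
Proof. exact/sym_connect_sym/induced_sym. Qed.

Lemma linked_sub X Y x y : X \subset Y -> linked X x y -> linked Y x y.
Proof.
move=> /subsetP sXY; apply: connect_sub => a b /and3P[aX bX ab].
by apply: connect1; rewrite /induced /= !sXY.
Qed.

Lemma two_linkedP A X s :
  reflect (exists x y, [/\ x \in A, y \in A, x != y &
                           [/\ adj G s x, adj G s y & linked X x y]])
          (two_linked A X s).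
Proof.
apply: (iffP existsP) => [[x /existsP[y /and5P[xA yA xy sx /andP[sy L]]]]|].
  by exists x, y; split=> //; rewrite neq_ltn xy.
case=> x [y [xA yA]]; rewrite neq_ltn => /orP[] xy [sx sy L].
  by exists x; apply/existsP; exists y; apply/and5P; split=> //; apply/andP.
exists y; apply/existsP; exists x; rewrite linked_sym in L.
by apply/and5P; split=> //; apply/andP.
Qed.

Lemma two_linked_sub A A' X X' s :
  A \subset A' -> X \subset X' -> two_linked A X s -> two_linked A' X' s.
Proof.
move=> /subsetP sA sX /two_linkedP[x [y [xA yA xy [sx sy L]]]].
by apply/two_linkedP; exists x, y; split; [exact: sA|exact: sA|done|split; last exact: linked_sub L].
Qed.

Lemma forest_sub X Y : X \subset Y -> forest G Y -> forest G X.
Proof.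
move=> /subsetP sXY fY [c [c3 uc cX cc]]; apply: fY; exists c; split=> //.
by move=> z /cX /sXY.
Qed.

Lemma path_in X x p : path (induced G X) x p -> {subset p <= X}.
Proof.
elim: p x => //= y p IH x /andP[/and3P[_ yX _] /IH sub] z.
by rewrite inE => /orP[/eqP->|/sub].
Qed.

Lemma path_linked X x p :
  x \in X -> {subset p <= X} -> path (adj G) x p -> linked X x (last x p).
Proof.
elim: p x => [|y p IH] x xX sub /=; first by move=> _; exact: connect0.
case/andP=> xy pp; have yX : y \in X by rewrite sub ?mem_head.
apply: (@connect_trans _ _ y); first by apply: connect1; rewrite /induced /= xX yX.
by apply: IH => // z zp; rewrite sub // inE zp orbT.
Qed.

Lemma path_adj X x p : path (induced G X) x p -> path (adj G) x p.
Proof. by apply: sub_path => a b /and3P[]. Qed.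

Lemma linked_cycle T v x y :
  v \notin T -> x \in T -> x != y -> adj G v x -> adj G v y -> linked T x y ->
  exists p, [/\ uniq (x :: p), {subset x :: p <= T}, path (adj G) x p,
                last x p = y & cycle (adj G) (v :: x :: p) /\ 1 < size (x :: p)].
Proof.
move=> vT xT xy vx vy /connectP[p pp ly]; move: vy xy; rewrite ly => {y ly}.
case: (shortenP pp) => p' pp' up' _ vy xy; exists p'; split=> //.
- by move=> z; rewrite inE => /orP[/eqP->//|]; exact: (path_in pp').
- exact: path_adj pp'.
- split; last by case: p' xy {pp' up' vy} => //=; rewrite eqxx.
  by rewrite /= rcons_path vx (path_adj pp') (adj_sym G).
Qed.

Lemma two_linked_not_forest T v : v \notin T -> two_linked T T v -> ~ forest G (v |: T).
Proof.
move=> vT /two_linkedP[x [y [xT yT xy [vx vy L]]]] fT.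
have [p [up sp pp lp [cp szp]]] := linked_cycle vT xT xy vx vy L.
apply: fT; exists (v :: x :: p); split=> //.
- by rewrite cons_uniq up andbT; apply/negP => /sp; apply/negP.
- by move=> z; rewrite !inE => /orP[->//|zp]; rewrite sp ?orbT // inE.
Qed.

(** A cycle in [v |: T] must pass through [v]; rotated to start there, its remainder is a path in
    [T] between two distinct neighbours of [v]. *)
Lemma forest_setU1 T v : forest G T -> ~~ two_linked T T v -> forest G (v |: T).
Proof.
move=> fT nP [c [c3 uc sc cc]].
have vc : v \in c.
  apply: contraT => nvc; case: fT; exists c; split=> // z zc.
  have := sc z zc; rewrite in_setU1 => /orP[/eqP zv|//].
  by rewrite -zv zc in nvc.
case/rot_to: vc => i p rc.
have: cycle (adj G) (v :: p) by rewrite -rc rot_cycle.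
have: uniq (v :: p) by rewrite -rc rot_uniq.
have: size (v :: p) = size c by rewrite -rc size_rot.
have: {subset v :: p <= v |: T} by move=> z; rewrite -rc mem_rot => /sc.
case: p {rc} => [|x p] /=; first by move=> _ sz; rewrite -sz in c3.
rewrite rcons_path => sp sz /and3P[vxp xp up] /and3P[vx pp lv].
have sT : {subset x :: p <= T}.
  move=> z zp; have := sp z; rewrite inE zp orbT in_setU1 => /(_ isT).
  by case/orP=> // /eqP zv; rewrite -zv zp in vxp.
case/negP: nP; apply/two_linkedP; exists x, (last x p); split.
- by rewrite sT ?mem_head.
- by rewrite sT // mem_last.
- case: p sz xp {vxp up pp lv sT sp} => [|y p] sz xp; first by rewrite -sz in c3.
  by apply: contraNneq xp => E; rewrite E /= mem_last.
- split=> //; first by rewrite (adj_sym G).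
  apply: path_linked => //; first by rewrite sT ?mem_head.
  by move=> z zp; rewrite sT // inE zp orbT.
Qed.

Definition nbh X u := [set v in X | adj G u v].

(* By [forest_setU1] and [two_linked_not_forest], the last clause is maximality. *)
Definition maxforest B T :=
  [/\ forest G T, T \subset B & forall w, w \in B -> w \notin T -> two_linked T T w].

(** The linked pair given by [two_linked] already exhausts the at most two neighbours of [w] in [B],
    so every neighbour in [B] belongs to that pair. *)
Lemma outer_nbh B T w z z' : T \subset B -> #|nbh B w| <= 2 -> two_linked T T w ->
  z \in B -> z' \in B -> adj G w z -> adj G w z' -> z \in T /\ linked T z z'.
Proof.
move=> /subsetP sTB d2 /two_linkedP[x [y [xT yT xy [wx wy L]]]] zB z'B wz wz'.
have E : [set x; y] = nbh B w.
  apply/eqP; rewrite eqEcard cards2 xy d2 andbT; apply/subsetP => a.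
  by rewrite !inE => /orP[]/eqP->; rewrite sTB.
have in2 a : a \in B -> adj G w a -> a = x \/ a = y.
  move=> aB wa; have : a \in nbh B w by rewrite inE aB.
  by rewrite -E !inE => /orP[]/eqP; [left|right].
case: (in2 z zB wz) => ->; split=> //;
  case: (in2 z' z'B wz') => -> //; try exact: connect0.
by rewrite linked_sym.
Qed.

(* A vertex of B outside T has both its B-neighbours in T, so a walk in B *)
(* through it can be rerouted inside T.                                  *)
Lemma linked_retract B T x y : T \subset B ->
  (forall w, w \in B -> w \notin T -> #|nbh B w| <= 2 /\ two_linked T T w) ->
  x \in T -> y \in T -> linked B x y -> linked T x y.
Proof.
move=> sTB H xT yT /connectP[p].
(* Invariant along the walk. At a vertex outside [T] it speaks of all neighbours in [B] instead, so
   the walk can leave that vertex in any direction. *)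
pose Q z : Prop := if z \in T then linked T x z : Prop
            else forall a, a \in B -> adj G z a -> linked T x a.
have: Q x by rewrite /Q xT; exact: connect0.
suff: forall z, Q z -> path (induced G B) z p -> Q (last z p).
  by move=> K Qx pp ly; have := K x Qx pp; rewrite -ly /Q yT.
elim: p => //= z' p IH z Qz /andP[/and3P[zB z'B zz'] pp]; apply: IH pp.
move: Qz; rewrite /Q; case: ifP => zT; case: ifP => z'T.
- by move/connect_trans; apply; apply: connect1; rewrite /induced /= zT z'T.
- move=> Lz a aB z'a; case: (H z' z'B (negbT z'T)) => d2 P.
  have z'z : adj G z' z by rewrite (adj_sym G).
  by have [_ L] := outer_nbh sTB d2 P zB aB z'z z'a; apply: connect_trans L.
- by move=> K; apply: K.
- move=> _; case: (H z zB (negbT zT)) => d2 P.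
  by have [] := outer_nbh sTB d2 P z'B z'B zz' zz'; rewrite z'T.
Qed.

(** * Exchange property: maximal forests between [F] and [B] have equal size *)

Section Exchange.
Variables (B F : {set 'I_n}).
Hypothesis deg2 : forall u, u \in B -> u \notin F -> #|nbh B u| <= 2.

(* Adding w to T1 closes a cycle, which leaves the forest T2 at some w2; since *)
(* w and w2 have degree at most two, w2 lies on every cycle of w |: T1.         *)
Lemma exchange T1 T2 w : maxforest B T1 -> maxforest B T2 ->
  F \subset T1 -> F \subset T2 -> w \in T2 -> w \notin T1 ->
  exists w2, [/\ w2 \in T1, w2 \notin T2 & maxforest B (w |: T1 :\ w2)].
Proof.
move=> [f1 s1 m1] [f2 s2 m2] F1 F2 wT2 wT1.
have wB : w \in B by exact: (subsetP s2).
have P1 := m1 w wB wT1; have wF : w \notin F by apply: contra wT1; exact: (subsetP F1).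
have [x [y [xT yT xy [wx wy L]]]] := two_linkedP _ _ _ P1.
have [p [up sp pp lp [cp szp]]] := linked_cycle wT1 xT xy wx wy L.
have /hasP[w2 w2p w2T2] : has [predC T2] (x :: p).
  apply: contraT => /hasPn K; case: f2; exists (w :: x :: p); split=> //.
    by rewrite cons_uniq up andbT; apply/negP => /sp; apply/negP.
  by move=> z; rewrite inE => /orP[/eqP->//|/K]; rewrite !inE negbK.
rewrite /= in w2T2; have w2T1 := sp _ w2p.
have w2F : w2 \notin F by apply: contra w2T2; exact: (subsetP F2).
have w2B : w2 \in B by exact: (subsetP s1).
have ww2 : w != w2 by apply: contraNneq wT1 => ->.
exists w2; split=> //.
(* Removing [w2] separates the neighbours of [w]. As [w] has at most two neighbours in [B], a linked
   pair [a], [b] would be [x], [y]; that link and the two pieces of the path [x :: p] around [w2]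
   would close a cycle through [w2] in [T1]. *)
have sep a b : a \in T1 :\ w2 -> b \in T1 :\ w2 -> a != b ->
    adj G w a -> adj G w b -> ~~ linked (T1 :\ w2) a b.
  move=> aT bT ab wa wb; apply/negP => Lab.
  have wlog2 : [/\ x != w2, y != w2 & linked (T1 :\ w2) x y].
    have E : [set a; b] = [set x; y].
      have -> : [set a; b] = nbh B w.
        apply/eqP; rewrite eqEcard cards2 ab deg2 // andbT.
        apply/subsetP => z; rewrite !inE => /orP[]/eqP->.
          by rewrite wa andbT (subsetP s1) //; case/setD1P: aT.
        by rewrite wb andbT (subsetP s1) //; case/setD1P: bT.
      apply/esym/eqP; rewrite eqEcard cards2 xy deg2 // andbT.
      by apply/subsetP => z; rewrite !inE => /orP[]/eqP->; rewrite ?wx ?wy andbT (subsetP s1).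
    have xab : x \in [set a; b] by rewrite E !inE eqxx.
    have yab : y \in [set a; b] by rewrite E !inE eqxx orbT.
    move: xab yab; rewrite !inE.
    case/setD1P: aT => aw _; case/setD1P: bT => bw _.
    case/orP=> /eqP xE /orP[]/eqP yE; rewrite ?xE ?yE in xy *; split=> //;
      rewrite ?eqxx // in xy *.
    by rewrite linked_sym.
  case: wlog2 => xw yw Lxy.
  have w2p' : w2 \in p by move: w2p; rewrite inE eq_sym (negbTE xw).
  move: up sp pp lp; case/splitPr: w2p' => p1 p2.
  rewrite cat_path last_cat /= -cat_cons => up sp /and3P[pp1 l1 pp2] lp.
  have: uniq ((x :: p1) ++ w2 :: p2) := up.
  rewrite cat_uniq => /and3P[_ dis0 /andP[w2p2 _]].
  have w2p1 : w2 \notin x :: p1 by apply: contra dis0 => H; apply/hasP; exists w2; rewrite ?mem_head.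
  have dis b2 : b2 \in p2 -> b2 \notin x :: p1.
    by move=> H; apply: contra dis0 => H'; apply/hasP; exists b2; rewrite // inE H orbT.
  have sT z : z \in x :: p1 \/ z \in p2 -> z \in T1 :\ w2.
    move=> zz; rewrite in_setD1 sp; last first.
      by rewrite mem_cat; apply/orP; case: zz => zz; [left|right; rewrite inE zz orbT].
    rewrite andbT; case: zz => zz; first by apply: contraNneq w2p1 => <-.
    by apply: contraNneq w2p2 => <-.
  case: p2 => [|b2 p2] in up pp2 lp dis0 dis w2p2 sp sT *; first by rewrite -lp eqxx in yw.
  case/andP: pp2 => wb2 pp2; rewrite /= in lp.
  apply: (@two_linked_not_forest (T1 :\ w2) w2).
  - by rewrite !inE eqxx.
  - apply/two_linkedP; exists (last x p1), b2; split.
    + by apply: sT; left; rewrite mem_last.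
    + by apply: sT; right; rewrite mem_head.
    + by apply: contraNneq (dis b2 (mem_head _ _)) => <-; rewrite mem_last.
    + split=> //; first by rewrite (adj_sym G).
      have xT' : x \in T1 :\ w2 by apply: sT; left; rewrite mem_head.
      have L1 : linked (T1 :\ w2) x (last x p1).
        by apply: path_linked => // z zp; apply: sT; left; rewrite inE zp orbT.
      have L2 : linked (T1 :\ w2) b2 y.
        rewrite -lp; apply: path_linked => //; first by apply: sT; right; rewrite mem_head.
        by move=> z zp; apply: sT; right; rewrite inE zp orbT.
      rewrite linked_sym in L1; apply: connect_trans L1 _.
      by rewrite linked_sym in L2; exact: connect_trans Lxy L2.
  - by rewrite setD1K.
have fT' : forest G (w |: T1 :\ w2).
  apply: forest_setU1; first exact: forest_sub (subD1set _ _) f1.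
  apply/negP => /two_linkedP[a [b [aT bT ab [wa wb Lab]]]].
  by have := sep a b aT bT ab wa wb; rewrite Lab.
have sT' : w |: T1 :\ w2 \subset B.
  by rewrite subUset sub1set wB (subset_trans (subD1set _ _)).
(* Otherwise [w2] could be put back, and [w |: T1] would be a forest. *)
have P2 : two_linked (w |: T1 :\ w2) (w |: T1 :\ w2) w2.
  apply: contraT => nP; case: (@two_linked_not_forest T1 w) => //.
  have -> : w |: T1 = w2 |: (w |: T1 :\ w2) by rewrite setUCA setD1K.
  exact: forest_setU1.
(* Maximality at the other vertices: [w3] keeps the pair of neighbours it has in [T1]. Neither of
   them is [w2], because all neighbours of [w2] in [B] belong to the new forest and [w3] does
   not. *)
split=> // w3 w3B; rewrite !inE !negb_or negb_and negbK => /andP[w3w /orP[/eqP->//|w3T1]].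
have w3F : w3 \notin F by apply: contra w3T1; exact: (subsetP F1).
have [a [b [aT bT ab [wa wb Lab]]]] := two_linkedP _ _ _ (m1 w3 w3B w3T1).
have in' z : z \in T1 -> adj G w3 z -> z \in w |: T1 :\ w2.
  move=> zT wz; rewrite !inE zT andbT; apply/orP; right.
  apply/eqP => zw2; rewrite zw2 (adj_sym G) in wz.
  have [] := outer_nbh sT' (deg2 w2B w2F) P2 w3B w3B wz wz.
  by rewrite !inE (negbTE w3w) (negbTE w3T1) andbF.
apply/two_linkedP; exists a, b; split=> //; try exact: in'.
(* With [w |: T1] as the ambient set, [w2] is the only vertex outside the new forest, so only
   passages through [w2] have to be rerouted. *)
split=> //; apply: (@linked_retract (w |: T1)); try exact: in'.
- by apply: setUS; exact: subD1set.
- move=> z; rewrite !inE => /orP[->//|zT].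
  rewrite negb_or zT andbT negbK => /andP[_ /eqP->]; split=> //.
  apply: leq_trans (deg2 w2B w2F); apply/subset_leq_card/subsetP => c.
  by rewrite !inE => /andP[/orP[/eqP->|/(subsetP s1)->] ->] //; rewrite wB.
- exact: linked_sub (subsetUr _ _) Lab.
Qed.

(** Exchanges preserve the size of [T1] and shrink [T2 :\: T1]: a vertex of [T2] enters and one
    outside [T2] leaves. Once [T2] is contained in [T1], maximality of [T2] gives equality. *)
Lemma card_maxforest T1 T2 : maxforest B T1 -> maxforest B T2 ->
  F \subset T1 -> F \subset T2 -> #|T1| = #|T2|.
Proof.
move=> M1 M2 F1 F2; have [m] := ubnP #|T2 :\: T1|.
elim: m T1 M1 F1 => // m IH T1 M1 F1 le; have [/eqP|] := set_0Vmem (T2 :\: T1).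
  rewrite setD_eq0 => s21; suff -> : T1 = T2 by [].
  apply/eqP; rewrite eqEsubset s21 andbT; apply/subsetP => w wT1.
  apply: contraT => wT2; case: M1 M2 => [f1 s1 _] [f2 s2 m2].
  case: (@two_linked_not_forest T2 w) => //; first exact: m2 (subsetP s1 _ wT1) wT2.
  by apply: forest_sub f1; rewrite subUset sub1set wT1.
case=> w /setDP[wT2 wT1].
have [w2 [w2T1 w2T2 M1']] := exchange M1 M2 F1 F2 wT2 wT1.
rewrite -(IH (w |: T1 :\ w2)) //.
- by rewrite cardsU1 !inE (negbTE wT1) andbF /= (cardsD1 w2 T1) w2T1.
- apply/subsetP => z zF; rewrite !inE (subsetP F1) // andbT.
  by apply/orP; right; apply: contraNneq w2T2 => <-; exact: (subsetP F2).
- rewrite -ltnS; apply: leq_trans le; rewrite ltnS; apply/proper_card/properP; split.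
    apply/subsetP => z; rewrite !inE => /andP[/norP[_ K] zT2]; rewrite zT2 andbT.
    by apply: contra K => zT1; rewrite zT1 andbT; apply: contraNneq w2T2 => <-.
  by exists w; rewrite !inE ?eqxx ?wT2 ?wT1.
Qed.
End Exchange.

(** * Minimal feedback vertex sets as complements of maximal forests *)

Lemma maxforest_minimal_fvs T : maxforest [set: 'I_n] T -> minimal_fvs G (~: T).
Proof.
case=> fT _ mT; split; first by rewrite /is_fvs setCK.
move=> Y /properP[sY [w]]; rewrite inE => wT wY fY.
apply: (two_linked_not_forest wT (mT w (in_setT w) wT)).
apply: forest_sub fY; rewrite subUset sub1set inE wY /=.
by rewrite subsetC.
Qed.

Lemma minimal_fvs_maxforest X : minimal_fvs G X -> maxforest [set: 'I_n] (~: X).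
Proof.
case=> fX mX; split=> // w _; rewrite inE negbK => wX.
apply: contraT => nP; case: (mX (X :\ w)); first exact: properD1.
rewrite /is_fvs (_ : ~: (X :\ w) = w |: ~: X); first exact: forest_setU1.
by apply/setP => z; rewrite !inE negb_and negbK.
Qed.

Lemma maxforest_subr B B' T : maxforest B T -> T \subset B' -> B' \subset B -> maxforest B' T.
Proof. by case=> fT _ mT sT /subsetP sB; split=> // w /sB; exact: mT. Qed.
End Graph.

(** * Greedy extension and branching *)

Section Greedy.
Variables (n : nat) (G : sgraph n).
Implicit Types (A B T X Y : {set 'I_n}) (s u v w x y z : 'I_n).

Definition expand X (R : {set _}) :=
  [set w | (w \in R) || (w \in X) && [exists z, (z \in R) && adj G z w]].

(** One breadth-first round per vertex; the index is ignored, so that this is an instance of bounded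
    iteration over vertices. *)
Definition reach X x := foldl (fun R _ => expand X R) [set x] (enum 'I_n).

Lemma reachE X x y : x \in X -> (y \in reach X x) = linked G X x y.
Proof.
move=> xX; rewrite /reach.
have key (l : seq 'I_n) : (forall y, y \in foldl (fun R _ => expand X R) [set x] l ->
           (y \in X) && linked G X x y) /\
         (forall p, path (induced G X) x p -> size p <= size l ->
           last x p \in foldl (fun R _ => expand X R) [set x] l).
  elim/last_ind: l => [|l a [IH1 IH2]].
    split=> [z|p _]; first by rewrite inE => /eqP->; rewrite xX; exact: connect0.
    by case: p => // _; rewrite inE.
  rewrite foldl_rcons size_rcons; split=> [z|].
    rewrite inE => /orP[/IH1//|/andP[zX /existsP[b /andP[/IH1/andP[bX L] bz]]]].
    rewrite zX; apply: connect_trans L _.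
    by apply: connect1; rewrite /induced /= bX zX.
  elim/last_ind=> [|p b _] pp sp.
    by rewrite inE; apply/orP; left; apply: (IH2 [::]).
  rewrite size_rcons ltnS in sp; rewrite rcons_path in pp.
  case/andP: pp => pp /and3P[lX bX lb]; rewrite last_rcons inE bX.
  by apply/orP; right; apply/existsP; exists (last x p); rewrite lb IH2.
have [k1 k2] := key (enum 'I_n); apply/idP/idP => [/k1/andP[]//|/connectP[p pp ->]].
(* A path without repetition has fewer than [n] edges, so [n] rounds reach its end. *)
case: (shortenP pp) => p' pp' up' _; apply: k2 => //.
rewrite size_enum_ord; apply: ltnW; rewrite -[X in _ <= X](card_ord n).
by rewrite -[_.+1]/(size (x :: p')) -(card_uniqP up') max_card.
Qed.

Definition add_acyclic A T v := if (v \in A) && ~~ two_linked G T T v then v |: T else T.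

Definition grow A T := foldl (add_acyclic A) T (enum 'I_n).

(** A vertex rejected in its turn stays rejected, since [two_linked] is monotone in the growing
    forest. Hence one pass is enough for maximality within [A]. *)
Lemma growP A T0 : forest G T0 -> [/\ forest G (grow A T0), T0 \subset grow A T0,
  grow A T0 \subset T0 :|: A &
  forall v, v \in A -> v \notin grow A T0 -> two_linked G (grow A T0) (grow A T0) v].
Proof.
move=> fT0.
suff [fT s1 s2 m] : let T := foldl (add_acyclic A) T0 (enum 'I_n) in
  [/\ forest G T, T0 \subset T, T \subset T0 :|: A &
  forall v, v \in enum 'I_n -> v \in A -> v \notin T -> two_linked G T T v].
  by split=> // v; apply: m; rewrite mem_enum.
elim/last_ind: (enum 'I_n) => [|l a [fT s1 s2 m]] /=.
  by split=> //; exact: subsetUl.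
rewrite foldl_rcons; set T := foldl _ _ _ in fT s1 s2 m *.
have sT : T \subset add_acyclic A T a.
  by rewrite /add_acyclic; case: ifP => // _; exact: subsetUr.
split.
- by rewrite /add_acyclic; case: ifP => // /andP[_ nP]; exact: forest_setU1.
- exact: subset_trans sT.
- rewrite /add_acyclic; case: ifP => // /andP[aA _].
  by rewrite subUset s2 sub1set inE aA orbT.
- move=> v vl vA nv; have [va|nva] := eqVneq v a; last first.
    rewrite mem_rcons inE (negbTE nva) /= in vl.
    by apply: two_linked_sub (m v vl vA _) => //; apply: contra nv; exact: (subsetP sT).
  rewrite va in vA nv *; apply: contraT => nP; rewrite /add_acyclic vA /= in nv nP.
  by case: ifP nv nP => [_|/negbFE ->//]; rewrite !inE eqxx.
Qed.

(** Applied to [F] and then [Z]: when [F :|: Z] is a forest, these two rounds of the greedy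
    extension reject nothing. *)
Lemma grow_full A T0 : forest G (T0 :|: A) -> grow A T0 = T0 :|: A.
Proof.
move=> f; have [_ s1 s2 m] := growP A (forest_sub (subsetUl _ _) f).
apply/eqP; rewrite eqEsubset s2 subUset s1; apply/subsetP => v vA.
apply: contraT => nv; case: (two_linked_not_forest nv (m v vA nv)).
apply: forest_sub f; rewrite subUset s2 andbT sub1set.
by rewrite inE vA orbT.
Qed.

Lemma forest0 : forest G set0.
Proof.
case=> -[|x c] [] //= _ _ sub _; have := sub x; rewrite mem_head inE.
by move/(_ isT).
Qed.

(** A deterministic choice in the form of a set with at most one element, because terms denote sets
    and not vertices. *)
Definition least (P : pred 'I_n) : {set 'I_n} :=
  [set v | P v && ~~ [exists w : 'I_n, (w < v) && P w]].

Lemma leastP (P : pred 'I_n) v0 : P v0 -> exists2 v, least P = [set v] & P v.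
Proof.
move=> Pv0; case: (arg_minnP (@nat_of_ord n) Pv0) => v Pv mv.
exists v => //; apply/setP => z; rewrite !inE; apply/andP/eqP => [[Pz nz]|->].
  apply: val_inj; apply/eqP; rewrite eqn_leq mv // andbT leqNgt.
  by apply: contra nz => vz; apply/existsP; exists v; rewrite vz.
by split=> //; apply/existsPn => w; apply/negP => /andP[wv /mv]; rewrite leqNgt wv.
Qed.
End Greedy.

(** * Lower bound for an attempt, branching, and the role of good vertices *)

Section Search.
Variables (n : nat) (I : instance n).
Notation G := (gr I).
Notation S := (inS I).
Notation F := (inF I).
Notation U := (inU I).
Implicit Types (Z D T : {set 'I_n}).

Definition base : {set 'I_n} := ~: S.
Notation B := base.

Definition sat Z := [set s in S | two_linked G (F :|: Z) B s].

Definition attempt Z := ~: grow G setT (grow G U (grow G Z (grow G F set0))).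

(* Vertices that no solution may delete. *)
Definition forced := [set u in U | [exists s, (s \in S) && ~~ two_linked G (B :\ u) B s]].

Definition unsat Z := least (fun s => (s \in S) && ~~ two_linked G (F :|: Z) B s).

Definition ends D s x y := [&& x \in B :\: D, y \in B :\: D, x != y,
  adj G s x, adj G s y & linked G B x y].

(* [lend] and [rend] are singletons {x}, {y} forming a linked pair of undeleted *)
(* neighbours of the least unsatisfied vertex, or empty if there is none.       *)
Definition lend Z D :=
  least (fun x => [exists s, (s \in unsat Z) && [exists y, ends D s x y]]).

Definition rend Z D := least (fun y =>
  [exists s, (s \in unsat Z) && [exists x, (x \in lend Z D) && ends D s x y]]).

Lemma baseE : B = F :|: U.
Proof.
apply/setP => z; rewrite !inE negb_or; case zF: (z \in F); rewrite ?andbT ?andbF //=.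
by apply/negP => zS; move/pred0P: (SF_disjoint I) => /(_ z); rewrite /= zS zF.
Qed.

(** Valid for every guess [Z], right or wrong: the last round offers all vertices, and this alone
    makes the forest maximal in the whole graph. *)
Lemma attempt_minimal Z : minimal_fvs G (attempt Z).
Proof.
rewrite /attempt.
have [f1 _ _ _] := growP F (@forest0 _ G).
have [f2 _ _ _] := growP Z f1; have [f3 _ _ _] := growP U f2.
have [f4 _ _ m4] := growP setT f3.
by apply: maxforest_minimal_fvs; split=> // w _; apply: m4.
Qed.

Hypothesis PR : path_restricted I.

Lemma base_deg2 u : u \in B -> u \notin F -> #|nbh G B u| <= 2.
Proof.
rewrite baseE inE => /orP[->//|uU] _.
have /PR[_ /(_ u)] : is_component G U [set y in U | connect (induced G U) u y].
  by exists u.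
rewrite in_set uU connect0 => /(_ isT) d; rewrite -d -baseE /deg.
by apply/subset_leq_card/subsetP => z; rewrite !inE => /andP[-> ->]; rewrite orbT.
Qed.

(* The complements of the solutions of the annotated problem, size aside. *)
Definition target T := [/\ maxforest G setT T, F \subset T & T \subset B].

Lemma yesP : yes_instance I ->
  exists2 T, target T & at_least (~: T) (par I).
Proof.
case=> X [mX kX SX dX]; exists (~: X); last by rewrite setCK.
split; first exact: minimal_fvs_maxforest.
  by rewrite subsetC; rewrite -disjoints_subset.
by rewrite /base setCS.
Qed.

Lemma target_maxforest T : target T -> maxforest G B T.
Proof. by case=> mT _ sT; apply: maxforest_subr mT _ _. Qed.

(** Since [F :|: Z] lies in the forest [T], it is kept entirely, and the forest [T3] obtained after
    the round for [U] is maximal in [B]. So [T3] and [T] have equal size, and [B :\: T3] is as large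
    as [B :\: T]. Links of [B] between vertices of [T3] persist in [T3], so the vertices of [sat Z]
    also close cycles with [T3]; all of these stay outside the final forest. *)
Lemma attempt_large T Z : target T -> Z \subset T ->
  [disjoint attempt Z & F] /\ #|sat Z| + #|B :\: T| <= #|attempt Z|.
Proof.
move=> tT ZT; have [[fT _ _] FT TB] := tT.
have fFZ : forest G (F :|: Z) by apply: forest_sub fT; rewrite subUset FT.
rewrite /attempt.
have -> : grow G F set0 = F.
  by rewrite grow_full set0U //; apply: forest_sub fFZ; rewrite ?set0U subsetUl.
rewrite (grow_full fFZ).
have [f3 s3 t3 m3] := growP U fFZ; set T3 := grow G U _ in f3 s3 t3 m3 *.
have [f4 s4 t4 m4] := growP setT f3; set T4 := grow G _ _ in f4 s4 t4 m4 *.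
have FT3 : F \subset T3 by apply: subset_trans s3; exact: subsetUl.
have T3B : T3 \subset B.
  apply: subset_trans t3 _; rewrite baseE !subUset subsetUl subsetUr -baseE /=.
  by rewrite andbT (subset_trans ZT).
have M3 : maxforest G B T3.
  split=> // w; rewrite baseE inE => /orP[wF|wU]; last exact: m3.
  by rewrite (subsetP FT3).
have out w : w \notin T3 -> two_linked G T3 T3 w -> w \notin T4.
  move=> wT3 P; apply/negP => wT4; apply: (two_linked_not_forest wT3 P).
  by apply: forest_sub f4; rewrite subUset sub1set wT4.
split.
  by rewrite disjoints_subset setCS; exact: subset_trans FT3 s4.
have -> : #|B :\: T| = #|B :\: T3|.
  rewrite !cardsD (setIidPr TB) (setIidPr T3B); congr (_ - _).
  exact: (card_maxforest base_deg2 (target_maxforest tT) M3).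
rewrite -cardsUI (_ : _ :&: _ = set0) ?cards0 ?addn0; last first.
  by apply/setP => z; rewrite !inE; case: (z \in S); rewrite ?andbF.
apply/subset_leq_card/subsetP => z; rewrite !inE.
case/orP=> [/andP[zS P]|/andP[zT3 zB]]; apply: out => //.
- by apply/negP => /(subsetP T3B); rewrite inE zS.
- case/two_linkedP: P => x [y [xA yA xy [zx zy L]]]; apply/two_linkedP; exists x, y.
  split=> //; [exact: (subsetP s3)|exact: (subsetP s3)|split=> //].
  apply: (@linked_retract _ _ B) => //; [|exact: (subsetP s3)|exact: (subsetP s3)].
  move=> w wB wT3; case: M3 => _ _ m; split; last exact: m.
  by apply: base_deg2 => //; apply: contra wT3; exact: (subsetP FT3).
- by case: M3 => _ _ m; apply: m => //; rewrite inE.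
Qed.

Lemma sat_sub Z Z' : Z \subset Z' -> sat Z \subset sat Z'.
Proof.
move=> ZZ'; apply/subsetP => s; rewrite !inE => /andP[-> /=].
by apply: two_linked_sub => //; exact: setUS.
Qed.

Lemma target_two_linked T s : target T -> s \in S -> two_linked G T T s.
Proof.
case=> -[_ _ m] _ TB sS; apply: m (in_setT s) _; apply/negP => /(subsetP TB).
by rewrite inE sS.
Qed.

(** Every vertex of [S] has a linked pair of neighbours in [T], hence outside [D], so a pair [x],
    [y] for the least unsatisfied vertex exists. The chosen pair may differ from the one in [T]; the
    three cases are [x] outside [T], [y] outside [T], and both in [T], where that vertex becomes
    satisfied. *)
Lemma branch T Z D : target T -> Z \subset T -> D \subset B :\: T -> sat Z != S ->
  [\/ D :|: lend Z D \subset B :\: T /\ #|D| < #|D :|: lend Z D|,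
      D :|: rend Z D \subset B :\: T /\ #|D| < #|D :|: rend Z D| |
      Z :|: lend Z D :|: rend Z D \subset T /\
      #|sat Z| < #|sat (Z :|: lend Z D :|: rend Z D)| ].
Proof.
move=> tT ZT DT satS; have [mT FT TB] := tT.
have [s us sP] : exists2 s, unsat Z = [set s] & (s \in S) && ~~ two_linked G (F :|: Z) B s.
  have /subsetPn[s0 s0S ns0] : ~~ (S \subset sat Z).
    apply: contra satS => sS; rewrite eqEsubset sS andbT.
    by apply/subsetP => z; rewrite inE => /andP[].
  by apply: (leastP (v0 := s0)); move: ns0; rewrite inE s0S.
have [x lx xP] : exists2 x, lend Z D = [set x] & [exists y, ends D s x y].
  have /andP[sS _] := sP; have [x [y [xT yT xy [sx sy L]]]] := two_linkedP _ _ _ _ (target_two_linked tT sS).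
  have inBD z : z \in T -> z \in B :\: D.
    move=> zT; rewrite inE (subsetP TB) // andbT; apply/negP => /(subsetP DT).
    by rewrite inE zT.
  have [|x' e] := @leastP _ (fun x => [exists s, (s \in unsat Z) && [exists y, ends D s x y]]) x.
    apply/existsP; exists s; rewrite us inE eqxx; apply/existsP; exists y.
    by rewrite /ends !inBD // xy sx sy (linked_sub TB).
  move=> /existsP[s' /andP[]]; rewrite us inE => /eqP-> K.
  by exists x'.
have [y ry yP] : exists2 y, rend Z D = [set y] & ends D s x y.
  case/existsP: xP => y0 y0P.
  have [|y' e] := @leastP _ (fun y => [exists s, (s \in unsat Z) &&
     [exists x, (x \in lend Z D) && ends D s x y]]) y0.
    apply/existsP; exists s; rewrite us inE eqxx; apply/existsP; exists x.
    by rewrite lx inE eqxx.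
  move=> /existsP[s' /andP[]]; rewrite us inE => /eqP-> /existsP[x' /andP[]].
  by rewrite lx inE => /eqP-> K; exists y'.
rewrite lx ry; case/and5P: yP => /setDP[xB xD] /setDP[yB yD] xy sx /andP[sy L].
have cardD z : z \notin D -> #|D| < #|D :|: [set z]| by move=> nz; rewrite setUC cardsU1 nz.
have [xT|xT] := boolP (x \in T); last first.
  by constructor 1; rewrite cardD // subUset DT sub1set inE xT.
have [yT|yT] := boolP (y \in T); last first.
  by constructor 2; rewrite cardD // subUset DT sub1set inE yT.
constructor 3; split; first by rewrite !subUset ZT !sub1set xT.
apply/proper_card/properP; split; first by apply: sat_sub; rewrite -setUA subsetUl.
case/andP: sP => sS nP; exists s; rewrite inE sS //.
by apply/two_linkedP; exists x, y; split; rewrite // !inE eqxx ?orbT.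
Qed.

(** If [T] missed [u], the linked pair that [T] provides for [s] would lie in [B :\ u], against the
    choice of [u]. *)
Lemma forced_sub T : target T -> forced \subset T.
Proof.
move=> tT; apply/subsetP => u; rewrite inE => /andP[uU /existsP[s /andP[sS nP]]].
apply: contraNT nP => nuT; apply: two_linked_sub (target_two_linked tT sS).
  case: tT => _ _ TB; apply/subsetP => z zT; rewrite inE (subsetP TB) // andbT inE.
  by apply: contraNneq nuT => <-.
by case: tT.
Qed.

(** A good vertex [s] has at most one neighbour [u] in [U]. If [F] alone contains no linked pair for
    [s], then every pair uses [u], so [u] is forced; either way a pair lies in [F :|: forced]. *)
Lemma good_sat : (forall s, s \in S -> two_linked G B B s) -> good I \subset sat forced.
Proof.
move=> H; apply/subsetP => s; rewrite !inE => /and3P[sS d2 d1]; rewrite sS /=.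
have [x [y [xB yB xy [sx sy L]]]] := two_linkedP _ _ _ _ (H s sS).
have one u v : u \in U -> v \in U -> adj G s u -> adj G s v -> u = v.
  move=> uU vU su sv; apply/eqP; move: d1; apply: contraTT => uv.
  rewrite -ltnNge; have <- : #|[set u; v]| = 2 by rewrite cards2 uv.
  apply/subset_leq_card/subsetP => z; rewrite !inE in uU vU *.
  by case/orP=> /eqP->; rewrite ?uU ?vU ?su ?sv orbT.
have [P|nP] := boolP (two_linked G F B s).
  by apply: two_linked_sub P => //; exact: subsetUl.
have in_forced u : u \in U -> adj G s u -> u \in forced.
  move=> uU su; rewrite inE uU; apply/existsP; exists s; rewrite sS /=.
  apply: contra nP => /two_linkedP[a [b [aB bB ab [sa sb Lab]]]].
  have inF' z : z \in B :\ u -> adj G s z -> z \in F.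
    rewrite in_setD1 baseE => /andP[zu /setUP[//|zU]] sz.
    by rewrite (one z u) ?eqxx in zu.
  by apply/two_linkedP; exists a, b; split=> //; apply: inF'.
have inFf z : z \in B -> adj G s z -> z \in F :|: forced.
  by rewrite baseE => /setUP[zF _|zU sz]; rewrite inE ?zF // in_forced ?orbT.
by apply/two_linkedP; exists x, y; split=> //; apply: inFf.
Qed.
End Search.

(** * The search as terms *)

Definition TIn X v := TMem v (TVar X).
Definition TOr f g := TNot (TAnd (TNot f) (TNot g)).
Definition TEq v w := TAnd (TNot (TLt v w)) (TNot (TLt w v)).
Definition TEmpty := TComp 8 (TLt 8 8).

(** Bound variables have fixed numbers, kept apart to avoid capture: 5, 6, 7 and set variable 9
    here, 1 and 2 in [TPair], 0, 8 and set variable 10 in [TGrow], 3 and 4 in [TLeast]. In [TGrow]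
    the formula [A] speaks of vertex variable 0. *)
Definition TReach X x :=
  TFold 9 5 (TComp 6 (TEq 6 x))
    (TComp 6 (TOr (TIn 9 6) (TAnd (TIn X 6) (TEx 7 (TAnd (TIn 9 7) (TAdj 7 6)))))).

Definition TPair (A : nat -> tm true) X s :=
  TEx 1 (TEx 2 (TAnd (A 1) (TAnd (A 2) (TAnd (TLt 1 2)
    (TAnd (TAdj s 1) (TAnd (TAdj s 2) (TMem 2 (TReach X 1)))))))).

Definition TGrow (A : tm true) (T0 : tm false) :=
  TFold 10 0 T0
    (TComp 8 (TOr (TIn 10 8) (TAnd (TEq 8 0) (TAnd A (TNot (TPair (TIn 10) 10 0)))))).

Definition TLeast (P : nat -> tm true) :=
  TComp 3 (TAnd (P 3) (TNot (TEx 4 (TAnd (TLt 4 3) (P 4))))).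

(* Set variables 0 to 5 hold S, F, Z, D, the complement of S, and U.           *)
Definition TBase := TComp 0 (TNot (TIn 0 0)).
Definition TU := TComp 0 (TNot (TOr (TIn 0 0) (TIn 1 0))).
Definition TSatPair s := TPair (fun v => TOr (TIn 1 v) (TIn 2 v)) 4 s.
Definition TSat := TComp 0 (TAnd (TIn 0 0) (TSatPair 0)).
Definition TNoPair := TEx 0 (TAnd (TIn 0 0) (TNot (TPair (TIn 4) 4 0))).
Definition TForced := TComp 8 (TAnd (TIn 5 8) (TEx 0 (TAnd (TIn 0 0)
  (TNot (TPair (fun v => TAnd (TNot (TEq v 8)) (TIn 4 v)) 4 0))))).
Definition TAttempt := TComp 8 (TNot (TMem 8
  (TGrow (TOr (TIn 0 0) (TNot (TIn 0 0)))
    (TGrow (TIn 5 0) (TGrow (TIn 2 0) (TGrow (TIn 1 0) TEmpty)))))).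
Definition TMeetsF := TEx 0 (TAnd (TIn 6 0) (TIn 1 0)).
Definition TUnsat := TLeast (fun v => TAnd (TIn 0 v) (TNot (TSatPair v))).
Definition TFree v := TAnd (TNot (TIn 3 v)) (TIn 4 v).
Definition TEnds s x y := TAnd (TFree x) (TAnd (TFree y) (TAnd (TNot (TEq x y))
  (TAnd (TAdj s x) (TAnd (TAdj s y) (TMem y (TReach 4 x)))))).
(** Here and in [TRend] set variable 6 holds the least unsatisfied vertex, whereas [TMeetsF] reads
    the attempt from it; 7 holds the left end. *)
Definition TLend := TLeast (fun x => TEx 0 (TAnd (TIn 6 0) (TEx 1 (TEnds 0 x 1)))).
Definition TRend := TLeast (fun y =>
  TEx 0 (TAnd (TIn 6 0) (TEx 1 (TAnd (TIn 7 1) (TEnds 0 1 y))))).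
Definition TUnion X Y := TComp 0 (TOr (TIn X 0) (TIn Y 0)).

(** * Denotations of the search terms *)

Section Semantics.
Variables (n : nat) (G : sgraph n).
Implicit Types (M : nat -> {set 'I_n}) (V : nat -> 'I_n).

Lemma sem_var M V X : sem G M V (TVar X) = M X.
Proof. by []. Qed.

Lemma sem_comp M V v f : sem G M V (TComp v f) = [set i | sem G M (upd V v i) f].
Proof. by []. Qed.

Lemma sem_fold M V X v e0 e1 : sem G M V (TFold X v e0 e1) =
  foldl (fun R i => sem G (upd M X R) (upd V v i) e1) (sem G M V e0) (enum 'I_n).
Proof. by []. Qed.

Lemma sem_mem M V v e : sem G M V (TMem v e) = (V v \in (sem G M V e : {set 'I_n})) :> bool.
Proof. by []. Qed.

Lemma sem_in M V v X : sem G M V (TIn X v) = (V v \in M X) :> bool.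
Proof. by []. Qed.

Lemma sem_adj M V v w : sem G M V (TAdj v w) = adj G (V v) (V w) :> bool.
Proof. by []. Qed.

Lemma sem_lt M V v w : sem G M V (TLt v w) = (V v < V w) :> bool.
Proof. by []. Qed.

Lemma sem_and M V f g : sem G M V (TAnd f g) = sem G M V f && sem G M V g :> bool.
Proof. by []. Qed.

Lemma sem_not M V f : sem G M V (TNot f) = ~~ sem G M V f :> bool.
Proof. by []. Qed.

Lemma sem_ex M V v f : sem G M V (TEx v f) = [exists i, sem G M (upd V v i) f] :> bool.
Proof. by []. Qed.

Lemma sem_or M V f g : sem G M V (TOr f g) = sem G M V f || sem G M V g :> bool.
Proof. by rewrite /= -negb_or negbK. Qed.

Lemma sem_eq M V v w : sem G M V (TEq v w) = (V v == V w) :> bool.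
Proof. by rewrite /= -!leqNgt andbC -eqn_leq. Qed.

Definition semE := (sem_or, sem_eq, sem_in, sem_var, sem_comp, sem_mem, sem_adj,
  sem_lt, sem_and, sem_not).

Lemma upd_eq T (f : nat -> T) x v : upd f x v x = v.
Proof. by rewrite /upd eqxx. Qed.

Lemma upd_neq T (f : nat -> T) x v y : (y == x) = false -> upd f x v y = f y.
Proof. by rewrite /upd => ->. Qed.

Lemma eq_foldl T R (f g : R -> T -> R) a l :
  (forall a x, f a x = g a x) -> foldl f a l = foldl g a l.
Proof. by move=> fg; elim: l a => //= x l IH a; rewrite fg IH. Qed.

Lemma sem_reach M V X x : (X == 9) = false -> x < 5 ->
  sem G M V (TReach X x) = reach G (M X) (V x).
Proof.
move=> X9 x5; have xn j : 4 < j -> (x == j) = false by lia.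
rewrite /TReach /reach sem_fold; set e0 := sem G M V _.
have -> : e0 = [set V x].
  by apply/setP => i; rewrite /e0 !semE !inE sem_eq upd_eq upd_neq ?xn.
apply: eq_foldl => R i; apply/setP => j.
rewrite !semE !inE !semE sem_ex upd_eq (upd_neq _ _ X9).
congr (_ || _ && _); apply: eq_existsb => z; by rewrite !semE.
Qed.

(** The inclusion of [A'] in [M X] supplies the membership under which [reachE] identifies
    reachability with linkedness. The conditions on [s] and [X] exclude capture. *)
Lemma sem_two_linked M V (A : nat -> tm true) (A' : {set 'I_n}) X s : (X == 9) = false -> s = 0 \/ (s == 3) || (s == 4) ->
  (forall x y, sem G M (upd (upd V 1 x) 2 y) (A 1) = (x \in A') :> bool) ->
  (forall x y, sem G M (upd (upd V 1 x) 2 y) (A 2) = (y \in A') :> bool) ->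
  A' \subset M X ->
  sem G M V (TPair A X s) = two_linked G A' (M X) (V s) :> bool.
Proof.
move=> X9 sn H1 H2 /subsetP AX; have [s1 s2] : (s == 1) = false /\ (s == 2) = false by lia.
rewrite /TPair sem_ex; apply: eq_existsb => x; rewrite sem_ex; apply: eq_existsb => y.
rewrite !semE H1 H2 sem_reach // !(upd_neq _ _ s2) !(upd_neq _ _ s1) /=.
have [xA|//] := boolP (x \in A'); congr (_ && _); congr (_ && _).
by rewrite reachE // AX.
Qed.

Lemma sem_grow M V (A : tm true) (A' : {set 'I_n}) T0 :
  (forall R i j, sem G (upd M 10 R) (upd (upd V 0 i) 8 j) A = (i \in A') :> bool) ->
  sem G M V (TGrow A T0) = grow G A' (sem G M V T0).
Proof.
move=> HA; rewrite /TGrow sem_fold; apply: eq_foldl => R i.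
apply/setP => j; rewrite !semE in_set !semE HA (@sem_two_linked _ _ _ R) //; [|by left].
rewrite /= /add_acyclic; case: ifP => _; rewrite ?andbF ?orbF // andbT.
by rewrite in_setU1 orbC.
Qed.

Lemma sem_least M V (P : nat -> tm true) (P' : pred 'I_n) :
  (forall i, sem G M (upd V 3 i) (P 3) = P' i :> bool) ->
  (forall i j, sem G M (upd (upd V 3 i) 4 j) (P 4) = P' j :> bool) ->
  sem G M V (TLeast P) = least P'.
Proof.
move=> H3 H4; apply/setP => i; rewrite !semE !inE !semE sem_ex H3; congr (_ && ~~ _).
by apply: eq_existsb => j; rewrite !semE H4.
Qed.

Lemma sem_union M V X Y : sem G M V (TUnion X Y) = M X :|: M Y.
Proof. by apply/setP => i; rewrite !semE !inE !semE. Qed.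
End Semantics.

Section SearchSemantics.
Variables (n : nat) (I : instance n) (M : nat -> {set 'I_n}) (V : nat -> 'I_n).
Notation G := (gr I).
Hypotheses (M0 : M 0 = inS I) (M1 : M 1 = inF I).

Lemma sem_base : sem G M V TBase = base I.
Proof. by apply/setP => i; rewrite !semE !inE !semE M0. Qed.

Lemma sem_U : sem G M V TU = inU I.
Proof. by apply/setP => i; rewrite !semE !inE !semE M0 M1. Qed.

Hypotheses (M4 : M 4 = base I) (M5 : M 5 = inU I).

Lemma sem_nopair : sem G M V TNoPair =
  [exists s, (s \in inS I) && ~~ two_linked G (base I) (base I) s] :> bool.
Proof.
rewrite sem_ex; apply: eq_existsb => s; rewrite !semE (@sem_two_linked _ _ _ _ _ (base I)) ?M0 ?M4 //.
- by left.
- by move=> x y; rewrite semE M4.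
- by move=> x y; rewrite semE M4.
Qed.

Lemma sem_satpair W s : s = 0 \/ (s == 3) || (s == 4) -> M 2 \subset base I ->
  sem G M W (TSatPair s) = two_linked G (inF I :|: M 2) (base I) (W s) :> bool.
Proof.
move=> hs sZ; rewrite (@sem_two_linked _ _ _ _ _ (inF I :|: M 2)) ?M4 //.
- by move=> x y; rewrite !semE M1 inE.
- by move=> x y; rewrite !semE M1 inE.
- by rewrite subUset sZ andbT baseE subsetUl.
Qed.

Lemma sem_sat : M 2 \subset base I -> sem G M V TSat = sat I (M 2).
Proof. by move=> sZ; apply/setP => i; rewrite !semE !inE !semE sem_satpair ?M0 //; left. Qed.

Lemma sem_forced : sem G M V TForced = forced I.
Proof.
apply/setP => u; rewrite !semE in_set !semE sem_ex [RHS]in_set M5; congr (_ && _).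
apply: eq_existsb => s; rewrite !semE M0 (@sem_two_linked _ _ _ _ _ (base I :\ u)) ?M4 //.
- by left.
- by move=> x y; rewrite !semE M4 in_setD1.
- by move=> x y; rewrite !semE M4 in_setD1.
- exact: subD1set.
Qed.

Lemma sem_attempt : sem G M V TAttempt = attempt I (M 2).
Proof.
apply/setP => v; rewrite !semE in_set sem_not sem_mem [RHS]in_setC; congr (~~ (_ \in _)).
rewrite (@sem_grow _ _ _ _ _ setT); last by move=> R i j; rewrite !semE orbN inE.
rewrite (@sem_grow _ _ _ _ _ (inU I)); last by move=> R i j; rewrite !semE -M5.
rewrite (@sem_grow _ _ _ _ _ (M 2)); last by move=> R i j; rewrite !semE.
rewrite (@sem_grow _ _ _ _ _ (inF I)); last by move=> R i j; rewrite !semE -M1.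
congr (grow _ _ (grow _ _ (grow _ _ (grow _ _ _)))).
by apply/setP => i; rewrite !semE !inE !semE ltnn.
Qed.

Lemma sem_meetsF : sem G M V TMeetsF = ~~ [disjoint M 6 & inF I] :> bool.
Proof.
rewrite sem_ex -setI_eq0; apply/existsP/set0Pn => -[i Hi]; exists i; move: Hi;
  by rewrite !semE -M1 inE.
Qed.

Lemma sem_unsat : M 2 \subset base I -> sem G M V TUnsat = unsat I (M 2).
Proof.
by move=> sZ; rewrite (sem_least (P' := fun s => (s \in inS I) && ~~ two_linked G (inF I :|: M 2) (base I) s)) //;
  [move=> i|move=> i j]; rewrite !semE sem_satpair ?M0 //; right.
Qed.

Lemma sem_ends W s x y : x < 5 ->
  sem G M W (TEnds s x y) = ends I (M 3) (W s) (W x) (W y) :> bool.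
Proof.
move=> x5; rewrite !semE sem_reach // M4 /ends !in_setD.
have [xB|] := boolP (_ \in base I); last by rewrite !andbF.
by rewrite reachE.
Qed.

Lemma sem_lend : M 6 = unsat I (M 2) -> sem G M V TLend = lend I (M 2) (M 3).
Proof.
move=> M6; rewrite (sem_least (P' := fun x => [exists s, (s \in unsat I (M 2)) &&
  [exists y, ends I (M 3) s x y]])) //; [move=> i|move=> i0 i];
  rewrite sem_ex; apply: eq_existsb => s; rewrite !semE sem_ex M6; congr (_ && _);
  by apply: eq_existsb => y; rewrite sem_ends.
Qed.

Lemma sem_rend : M 6 = unsat I (M 2) -> M 7 = lend I (M 2) (M 3) ->
  sem G M V TRend = rend I (M 2) (M 3).
Proof.
move=> M6 M7; rewrite (sem_least (P' := fun y => [exists s, (s \in unsat I (M 2)) &&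
  [exists x, (x \in lend I (M 2) (M 3)) && ends I (M 3) s x y]])) //; [move=> i|move=> i0 i];
  rewrite sem_ex; apply: eq_existsb => s; rewrite !semE sem_ex M6; congr (_ && _);
  by apply: eq_existsb => y; rewrite sem_and sem_in M7 sem_ends.
Qed.
End SearchSemantics.

(** * One level of the search tree *)

Section SearchStep.
Variables (n : nat) (I : instance n) (k : nat).
Notation S := (inS I).
Notation F := (inF I).
Notation B := (base I).
Implicit Types (Z D T : {set 'I_n}).

Definition accepted (A : {set 'I_n}) := [disjoint A & F] && (k <= #|A|).

Definition entry : Type := {set 'I_n} * {set 'I_n} * nat.

Definition children Z D f : seq entry :=
  [:: (Z :|: lend I Z D :|: rend I Z D, D, f); (Z, D :|: rend I Z D, f); (Z, D :|: lend I Z D, f)].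

(** An entry consistent with a hidden solution [T]. The last clause is the potential argument: each
    right branch raises the first two summands by at least one in total and spends one unit of the
    budget [e.2]. *)
Definition promising T (e : entry) :=
  [/\ e.1.1 \subset T, e.1.2 \subset B :\: T & k <= #|sat I e.1.1| + #|e.1.2| + e.2].

Lemma lend_sub Z D : lend I Z D \subset B.
Proof.
apply/subsetP => x; rewrite in_set => /andP[/existsP[s /andP[_ /existsP[y /and3P[]]]]].
by case/setDP.
Qed.

Lemma rend_sub Z D : rend I Z D \subset B.
Proof.
apply/subsetP => y; rewrite in_set.
by case/andP=> /existsP[s /andP[_ /existsP[x /and4P[_ _ /setDP[]]]]].
Qed.

Lemma card_target_compl T : T \subset B -> #|~: T| = #|S| + #|B :\: T|.
Proof.
move=> TB; rewrite -cardsUI (_ : _ :&: _ = set0) ?cards0 ?addn0; last first.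
  by apply/setP => z; rewrite !inE; case: (z \in S); rewrite ?andbF.
congr #|pred_of_set _|; apply/setP => z; rewrite !inE.
case zT: (z \in T); case zS: (z \in S) => //=.
by have := subsetP TB z zT; rewrite inE zS.
Qed.

(** By [attempt_large] the attempt avoids [F], so its rejection means that it is smaller than [k].
    With [sat Z = S] it would be as large as the complement of [T], and with zero budget at least
    [k]; hence branching is possible and affordable. *)
Lemma promising_step T Z D f : path_restricted I -> target I T -> k <= #|~: T| ->
  ~~ accepted (attempt I Z) -> promising T (Z, D, f) ->
  exists2 f', f = f'.+1 & exists2 e, e \in children Z D f' & promising T e.
Proof.
move=> PR tT kT nA [/= ZT DT kf]; have [_ _ TB] := tT.
have [dis le] := attempt_large PR tT ZT.
rewrite /accepted dis /= -ltnNge in nA; have leD := subset_leq_card DT.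
have satS : sat I Z != S.
  apply: contraL nA => /eqP E; rewrite -leqNgt; apply: leq_trans le.
  by rewrite E -card_target_compl.
have kle a b c d e : k <= a + b + d -> b <= c -> a + c <= e -> e < k -> 0 < d by lia.
case: f kf => [|f] kf; first by have := kle _ _ _ _ _ kf leD le nA.
have ltD a b c : k <= a + b + f.+1 -> b < c -> k <= a + c + f by lia.
have ltS a b c : k <= a + b + f.+1 -> a < c -> k <= c + b + f by lia.
exists f => //; case: (branch tT ZT DT satS) => -[s1 lt].
- by exists (Z, D :|: lend I Z D, f); [rewrite !inE eqxx !orbT|split=> //=; exact: ltD kf lt].
- by exists (Z, D :|: rend I Z D, f); [rewrite !inE eqxx !orbT|split=> //=; exact: ltD kf lt].
- by exists (Z :|: lend I Z D :|: rend I Z D, D, f); [rewrite !inE eqxx|split=> //=; exact: ltS kf lt].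
Qed.

Lemma attempt_correct Z : accepted (attempt I Z) ->
  [/\ minimal_fvs (gr I) (attempt I Z), attempt I Z \subset S :|: inU I & k <= #|attempt I Z|].
Proof.
case/andP=> dis le; split=> //; first exact: attempt_minimal.
apply/subsetP => z zA; rewrite !inE; case zS: (z \in S) => //=.
by apply/negP => zF; move/pred0P: dis => /(_ z); rewrite /= zA zF.
Qed.
End SearchStep.

(** * The search program *)

(* Memory layout: 1 graph, 2 to 10 the set variables 0 to 8 (17 serves all     *)
(* others), 11 the threshold k, 12 the branching budget, 13 the stack,         *)
(* 14 the result, 15 the constant vertex 0, 16 a counter, from 18 on scratch.  *)
Definition reg X := if X < 9 then X.+2 else 17.

Definition run_set j (t : tm false) := CSeq (compile reg (fun=> 15) 18 t) (CAssign (reg j) (EVar 18)).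

Definition run_test (t : tm true) c1 c2 := CSeq (compile reg (fun=> 15) 18 t) (CIf (EVar 18) c1 c2).

(** Takes one unit off the counter in 16 per element of the set. From [k] it ends at the truncated
    difference, which is [Leaf] exactly when the set has at least [k] elements. *)
Definition run_count j :=
  CSeq (CAssign 18 (EVar (reg j)))
    (CWhile (EVar 18)
       (CSeq (CIf (EHd (EVar 18)) (CAssign 16 (ETl (EVar 16))) (CAssign 16 (EVar 16)))
             (CAssign 18 (ETl (EVar 18))))).

Definition run_push x y :=
  CAssign 13 (ECons (ECons (EVar (reg x)) (ECons (EVar (reg y)) (EVar 12))) (EVar 13)).

Section Machine.
Variables (n : nat) (I : instance n).
Notation G := (gr I).
Implicit Types (M : nat -> {set 'I_n}).

Definition enc_entry (e : entry n) := Node (enc_set e.1.1) (Node (enc_set e.1.2) (enc_nat e.2)).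

Definition holds M k f c stk r (s : store) :=
  [/\ s 1 = enc_graph G, forall X, s (reg X) = enc_set (M X),
      [/\ s 11 = enc_nat k, s 12 = enc_nat f & s 16 = enc_nat c],
      s 13 = enc_seq (map enc_entry stk) & s 14 = r /\ s 15 = Leaf].

Lemma reg_lt X : reg X < 18.
Proof. by rewrite /reg; case: ifP; lia. Qed.

Lemma reg_neq X x : 10 < x < 17 -> (reg X == x) = false.
Proof. by rewrite /reg; case: ifP; lia. Qed.

Lemma update_reg s X x v : 10 < x < 17 -> update s x v (reg X) = s (reg X).
Proof. by move=> h; rewrite /update reg_neq. Qed.

Lemma holds_keeps M k f c stk r s s' :
  holds M k f c stk r s -> keeps 18 s s' -> holds M k f c stk r s'.
Proof.
move=> [h1 h2 [h3 h4 h5] h6 [h7 h8]] K; split; rewrite ?K //.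
by move=> X; rewrite K ?reg_lt.
Qed.

Lemma holds_fuel M k f f' c stk r s v : holds M k f c stk r s -> v = enc_nat f' ->
  holds M k f' c stk r (update s 12 v).
Proof.
by move=> [h1 h2 [h3 h4 h5] h6 [h7 h8]] ->; split=> // X; rewrite update_reg.
Qed.

Lemma holds_count M k f c c' stk r s v : holds M k f c stk r s -> v = enc_nat c' ->
  holds M k f c' stk r (update s 16 v).
Proof.
by move=> [h1 h2 [h3 h4 h5] h6 [h7 h8]] ->; split=> // X; rewrite update_reg.
Qed.

Lemma holds_stack M k f c stk stk' r s v : holds M k f c stk r s ->
  v = enc_seq (map enc_entry stk') -> holds M k f c stk' r (update s 13 v).
Proof.
by move=> [h1 h2 [h3 h4 h5] h6 [h7 h8]] ->; split=> // X; rewrite update_reg.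
Qed.

Lemma holds_result M k f c stk r r' s : holds M k f c stk r s ->
  holds M k f c stk r' (update s 14 r').
Proof.
by move=> [h1 h2 [h3 h4 h5] h6 [h7 h8]]; split=> // X; rewrite update_reg.
Qed.

Lemma holds_set M k f c stk r s j A v : j < 9 -> holds M k f c stk r s -> v = enc_set A ->
  holds (upd M j A) k f c stk r (update s (reg j) v).
Proof.
move=> j9 [h1 h2 [h3 h4 h5] h6 [h7 h8]] ->.
have E : reg j = j.+2 by rewrite /reg j9.
have hi x : (x < 2) || (10 < x) -> (x == j.+2) = false by lia.
split; rewrite ?E /update ?hi //.
move=> X; have := h2 X; rewrite /upd /reg; have [X9|X9] := boolP (X < 9) => H.
  by rewrite !eqSS; case: eqP.
by rewrite hi //; case: eqP => // Xj; rewrite Xj j9 in X9.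
Qed.

Lemma count_enum (A : {set 'I_n}) : count id [seq i \in A | i <- enum 'I_n] = #|A|.
Proof. by rewrite count_map -sum1_count big_enum_cond sum1_card. Qed.

Lemma runs_count M k f c stk r s j : holds M k f c stk r s ->
  runs (run_count j) s (20 * n + 10) (holds M k f (c - #|M j|) stk r).
Proof.
move=> H; pose l := [seq i \in M j | i <- enum 'I_n].
have sl : size l = n by rewrite size_map size_enum_ord.
have loop l1 c1 s1 : holds M k f c1 stk r s1 -> s1 18 = enc_seq (map enc_bool l1) ->
  runs (CWhile (EVar 18)
       (CSeq (CIf (EHd (EVar 18)) (CAssign 16 (ETl (EVar 16))) (CAssign 16 (EVar 16)))
             (CAssign 18 (ETl (EVar 18))))) s1 (20 * size l1 + 5)
    (holds M k f (c1 - count id l1) stk r).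
  elim: l1 c1 s1 => [|b l1 IH] c1 s1 H1 h1.
    by apply: runs_while_end; rewrite //= ?h1 // subn0.
  apply: (@runs_while_step _ _ _ _ 10 (20 * size l1 + 5) (fun s2 =>
     holds M k f (c1 - b) stk r s2 /\ s2 18 = enc_seq (map enc_bool l1))).
  - by rewrite /= h1.
  - apply: (@runs_seq _ _ _ _ 7 3 (fun s2 =>
       holds M k f (c1 - b) stk r s2 /\ s2 18 = enc_seq (map enc_bool (b :: l1)))) => //.
      apply: (@runs_if _ _ _ _ 3) => //=; rewrite h1 /= is_node_bool.
      case: b {h1 IH} (h1) => h1; apply: runs_assign => //=; split=> //;
        apply: (holds_count H1); case: H1 => _ _ [_ _ ->] _ _.
        by rewrite tl_enc_nat subn1.
      by rewrite subn0.
    move=> s2 [H2 h2]; apply: runs_assign => //=; split; last by rewrite update_eq h2.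
    by apply: holds_keeps H2 _; exact: keeps_update.
  - by move=> s2 [H2 h2]; rewrite /= subnDA; exact: IH.
  - rewrite /=; lia.
apply: (@runs_seq _ _ _ _ 2 (20 * n + 5) (fun s2 => holds M k f c stk r s2 /\
   s2 18 = enc_seq (map enc_bool l))); last by lia.
  apply: runs_assign => //=; split.
    by apply: holds_keeps H _; exact: keeps_update.
  by rewrite update_eq; case: H => _ -> _ _ _; rewrite /enc_set /l -map_comp.
by move=> s2 [H2 h2]; rewrite -count_enum -/l -{1}sl; exact: loop.
Qed.

Lemma runs_push M k f c stk r s x y : holds M k f c stk r s ->
  runs (run_push x y) s 8 (holds M k f c ((M x, M y, f) :: stk) r).
Proof.
move=> H; apply: runs_assign => //=; apply: (holds_stack H).
by case: H => _ h [_ -> _] -> _; rewrite !h.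
Qed.
(** All vertex variables are initially read from variable 15, whose content [Leaf] is the code of
    vertex 0. Such a vertex must exist, so the graph without vertices is treated apart. *)
Variable v0 : 'I_n.
Hypothesis v00 : v0 = 0 :> nat.

Lemma holds_models M k f c stk r s : holds M k f c stk r s ->
  models G M (fun=> v0) reg (fun=> 15) 18 s.
Proof.
move=> [h1 h2 _ _ [_ h8]]; split=> // [X|v]; first by rewrite reg_lt.
by rewrite h8 v00.
Qed.

Lemma runs_set M k f c stk r s j (t : tm false) : j < 9 -> holds M k f c stk r s ->
  runs (run_set j t) s (cost t n + 2) (holds (upd M j (sem G M (fun=> v0) t)) k f c stk r).
Proof.
move=> j9 H; apply: runs_seq (runs_compile _ (holds_models H)) _ (leqnn _) => s1 [h1 k1].
apply: runs_assign => //=; apply: holds_set => //; exact: holds_keeps H k1.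
Qed.

Lemma runs_test M k f c stk r s (t : tm true) c1 c2 b P : holds M k f c stk r s ->
  (forall s', holds M k f c stk r s' ->
     if (sem G M (fun=> v0) t : bool) then runs c1 s' b P else runs c2 s' b P) ->
  runs (run_test t c1 c2) s (cost t n + (b + 2)) P.
Proof.
move=> H K; apply: runs_seq (runs_compile _ (holds_models H)) _ (leqnn _) => s1 [h1 k1].
apply: (runs_if (b := b)) => /=; last by lia.
by rewrite h1 is_node_bool; apply: K; exact: holds_keeps H k1.
Qed.

End Machine.

Local Notation "c1 ;; c2" := (CSeq c1 c2) (at level 90, right associativity).

(** After both ends have been computed, register 6 is free to hold the new set of each child. With
    no budget left, the node is dropped and the self-assignment acts as a skip. *)
Definition run_next :=
  CIf (EVar 12)
    (CAssign 12 (ETl (EVar 12)) ;;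
     run_set 6 TUnsat ;; run_set 7 TLend ;; run_set 8 TRend ;;
     run_set 6 (TUnion 3 7) ;; run_push 2 6 ;;
     run_set 6 (TUnion 3 8) ;; run_push 2 6 ;;
     run_set 6 (TUnion 2 7) ;; run_set 6 (TUnion 6 8) ;; run_push 6 3)
    (CAssign 12 (EVar 12)).

(** Acceptance stores the attempt and empties the stack, which ends the loop. *)
Definition run_body :=
  CAssign (reg 2) (EHd (EHd (EVar 13))) ;;
  CAssign (reg 3) (EHd (ETl (EHd (EVar 13)))) ;;
  CAssign 12 (ETl (ETl (EHd (EVar 13)))) ;;
  CAssign 13 (ETl (EVar 13)) ;;
  run_set 6 TAttempt ;;
  run_test TMeetsF run_next
    (CAssign 16 (EVar 11) ;; run_count 6 ;;
     CIf (EVar 16) run_next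
       (CAssign 14 (ECons ENil (EVar (reg 6))) ;; CAssign 13 ENil)).

Definition run_search :=
  run_set 2 TForced ;; run_set 6 TSat ;;
  CAssign 16 (EVar 11) ;; run_count 6 ;; CAssign 12 (EVar 16) ;;
  run_set 3 TEmpty ;; run_push 2 3 ;;
  CWhile (EVar 13) run_body ;; CAssign 0 (EVar 14).

(** Filling the set registers with [S] only ensures that each of them contains the code of some set,
    as [holds] demands. *)
Definition run_solve :=
  CAssign 2 (EHd (ETl (EVar 0))) ;;
  CAssign 4 (EVar 2) ;; CAssign 5 (EVar 2) ;; CAssign 6 (EVar 2) ;; CAssign 7 (EVar 2) ;;
  CAssign 8 (EVar 2) ;; CAssign 9 (EVar 2) ;; CAssign 10 (EVar 2) ;; CAssign 17 (EVar 2) ;;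
  CAssign 3 (EHd (ETl (ETl (EVar 0)))) ;;
  run_set 4 TBase ;; run_set 5 TU ;;
  run_test TNoPair (CAssign 0 ENil) run_search.

Definition run_main :=
  CAssign 1 (EHd (EVar 0)) ;;
  CIf (EHd (ETl (ETl (ETl (EVar 0))))) (CAssign 11 ENil)
      (CAssign 11 (ETl (ETl (ETl (ETl (EVar 0)))))) ;;
  CIf (EVar 1) run_solve
      (CIf (EVar 11) (CAssign 0 ENil) (CAssign 0 (ECons ENil ENil))).

Definition next_cost n :=
  3 + ((cost TUnsat n + 2) + ((cost TLend n + 2) + ((cost TRend n + 2) +
  ((cost (TUnion 3 7) n + 2) + (8 + ((cost (TUnion 3 8) n + 2) + (8 +
  ((cost (TUnion 2 7) n + 2) + ((cost (TUnion 6 8) n + 2) + 8))))))))).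

Definition body_cost n :=
  4 + (5 + (5 + (3 + ((cost TAttempt n + 2) +
  (cost TMeetsF n + ((2 + ((20 * n + 10) + (next_cost n + 20))) + 2)))))).

(* Number of nodes of a ternary search tree of depth f. *)
Fixpoint weight f := if f is f'.+1 then (3 * weight f').+1 else 1.

Lemma weight_le f : (weight f).+1 <= 2 * 3 ^ f.
Proof. by elim: f => // f IH; rewrite /= expnS; lia. Qed.

(** * Correctness and running time of the search loop *)

Section Machine.
Variables (n : nat) (I : instance n) (v0 : 'I_n).
Hypothesis v00 : v0 = 0 :> nat.
Notation G := (gr I).
Notation holds := (holds I).
Implicit Types (M : nat -> {set 'I_n}).

Definition input_sets M :=
  [/\ M 0 = inS I, M 1 = inF I, M 4 = base I & M 5 = inU I].

Definition pushed (Z D : {set 'I_n}) f stk : seq (entry n) :=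
  if f is f'.+1 then children I Z D f' ++ stk else stk.

Lemma runs_next M k f c stk r s : holds M k f c stk r s -> input_sets M ->
  M 2 \subset base I ->
  runs run_next s (next_cost n + 4) (fun s' => exists M' f',
    input_sets M' /\ holds M' k f' c (pushed (M 2) (M 3) f stk) r s').
Proof.
move=> H IM sZ; have [M0 M1 M4 M5] := IM; have [_ _ [_ h12 _] _ _] := H.
apply: (runs_if (b := next_cost n)) => /=; last by lia.
rewrite h12 enc_nat_node; case: f H h12 => [|f] H h12 /=.
  apply: runs_assign => /=; first by rewrite /next_cost; lia.
  by exists M, 0; split; last exact: (holds_fuel H h12).
rewrite /next_cost.
apply: (runs_seq (Q := holds M k f c stk r) _ _ (leqnn _)).
  by apply: runs_assign => //=; apply: (holds_fuel H); rewrite h12.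
move=> s1 H1; apply: runs_seq (runs_set v00 TUnsat _ H1) _ (leqnn _) => // {s1 H1} s1.
rewrite sem_unsat // => H1.
apply: runs_seq (runs_set v00 TLend _ H1) _ (leqnn _) => // {s1 H1} s1.
rewrite sem_lend // => H1.
apply: runs_seq (runs_set v00 TRend _ H1) _ (leqnn _) => // {s1 H1} s1.
rewrite sem_rend // => H1.
apply: runs_seq (runs_set v00 _ _ H1) _ (leqnn _) => // {s1 H1} s1; rewrite sem_union => H1.
apply: runs_seq (runs_push _ _ H1) _ (leqnn _) => {s1 H1} s1 H1.
apply: runs_seq (runs_set v00 _ _ H1) _ (leqnn _) => // {s1 H1} s1; rewrite sem_union => H1.
apply: runs_seq (runs_push _ _ H1) _ (leqnn _) => {s1 H1} s1 H1.
apply: runs_seq (runs_set v00 _ _ H1) _ (leqnn _) => // {s1 H1} s1; rewrite sem_union => H1.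
apply: runs_seq (runs_set v00 _ _ H1) _ (leqnn _) => // {s1 H1} s1; rewrite sem_union => H1.
apply: runs_weaken (runs_push _ _ H1) (leqnn _) _ => {s1 H1} s1 H1.
by eexists; eexists; split; last exact: H1.
Qed.

Lemma runs_body M k f0 c Z D f stk s :
  holds M k f0 c ((Z, D, f) :: stk) Leaf s -> input_sets M -> Z \subset base I ->
  runs run_body s (body_cost n) (fun s' => exists M' f' c', input_sets M' /\
    if accepted I k (attempt I Z)
    then holds M' k f' c' [::] (Node Leaf (enc_set (attempt I Z))) s'
    else holds M' k f' c' (pushed Z D f stk) Leaf s').
Proof.
move=> H [M0 M1 M4 M5] sZ; rewrite /body_cost.
have [_ _ [_ _ _] /= h13 _] := H.
apply: (runs_seq (Q := holds (upd M 2 Z) k f0 c ((Z, D, f) :: stk) Leaf) _ _ (leqnn _)).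
  by apply: runs_assign => //=; apply: holds_set H _ => //; rewrite h13.
move=> s1 {h13 H} H; have [_ _ _ /= h13 _] := H.
apply: (runs_seq (Q := holds (upd (upd M 2 Z) 3 D) k f0 c ((Z, D, f) :: stk) Leaf) _ _ (leqnn _)).
  by apply: runs_assign => //=; apply: holds_set H _ => //; rewrite h13.
move=> s2 {h13 H} H; have [_ _ _ /= h13 _] := H.
apply: (runs_seq (Q := holds (upd (upd M 2 Z) 3 D) k f c ((Z, D, f) :: stk) Leaf) _ _ (leqnn _)).
  by apply: runs_assign => //=; apply: holds_fuel H _ => //; rewrite h13.
move=> s3 {h13 H} H; have [_ _ _ /= h13 _] := H.
apply: (runs_seq (Q := holds (upd (upd M 2 Z) 3 D) k f c stk Leaf) _ _ (leqnn _)).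
  by apply: runs_assign => //=; apply: holds_stack H _ => //; rewrite h13.
move=> s4 {h13 H} H.
apply: runs_seq (runs_set v00 TAttempt _ H) _ (leqnn _) => // {H} s5.
rewrite sem_attempt //; set M' := upd _ 6 _ => H.
have IM : input_sets M' by [].
apply: (runs_test v00 H) => {H} s6 H; rewrite sem_meetsF // [M' 6]/=.
have next s' c' b : holds M' k f c' stk Leaf s' -> next_cost n + 4 <= b ->
   runs run_next s' b (fun s' => exists M' f' c', input_sets M' /\
     holds M' k f' c' (pushed Z D f stk) Leaf s').
  move=> H' le; apply: runs_weaken (runs_next H' IM sZ) le _.
  by move=> s'' [M'' [f' H'']]; exists M'', f', c'.
rewrite /accepted; case: ifP => [/negbTE ->|/negbFE ->] /=.
  by apply: next H _; lia.
apply: (runs_seq (Q := holds M' k f k stk Leaf) _ _ (leqnn _)).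
  by apply: runs_assign => //=; apply: (holds_count H); case: H => _ _ [].
move=> {H} s7 H; apply: runs_seq (runs_count 6 H) _ (leqnn _) => {H} s8 H.
have [_ Hreg [_ _ h16] _ _] := H.
apply: (runs_if (b := next_cost n + 18)); last by rewrite /=; lia.
rewrite [eval _ _]/= h16 enc_nat_node subn_gt0 ltnNge; case: ifP => /=.
  by move/negbTE->; apply: next H _; lia.
move/negbFE->; apply: (@runs_seq _ _ _ _ 4 2 (holds M' k f (k - #|M' 6|) stk
   (Node Leaf (enc_set (attempt I Z))))); last by lia.
  by apply: runs_assign => //=; rewrite -[8]/(reg 6) Hreg; apply: holds_result H.
move=> s9 {Hreg h16 H} H; apply: runs_assign => //=; exists M', f, (k - #|M' 6|).
by split=> //; apply: holds_stack H _.
Qed.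

Definition stack_weight (stk : seq (entry n)) := \sum_(e <- stk) weight e.2.

(** A negative result only excludes solutions for which an entry of the stack is promising. This
    relative form passes from the stack after a step to the stack before it. *)
Definition search_result k (stk : seq (entry n)) (r : option {set 'I_n}) :=
  if r is Some A then
    [/\ minimal_fvs G A, A \subset inS I :|: inU I & k <= #|A|]
  else forall T, target I T -> k <= #|~: T| ->
    forall e, e \in stk -> ~ promising I k T e.

Hypothesis PR : path_restricted I.

(** Induction on the total weight of the stack, which bounds the number of iterations; the
    additional unit pays for the final loop test. *)
Lemma runs_loop M k f c stk s :
  holds M k f c stk Leaf s -> input_sets M ->
  (forall e, e \in stk -> e.1.1 \subset base I) ->
  runs (CWhile (EVar 13) run_body) s ((stack_weight stk).+1 * (body_cost n + 10))
    (fun s' => exists2 r, s' 14 = enc_answer r & search_result k stk r).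
Proof.
have [m] := ubnP (stack_weight stk).
elim: m M f c stk s => // m IH M f c stk s lem H IM sB.
case: stk lem H sB => [|[[Z D] g] stk] lem H sB; have [_ _ _ h13 [h14 _]] := H.
  apply: runs_while_end; [by rewrite /= h13|by rewrite /stack_weight big_nil /=; lia|].
  by exists None.
have sZ : Z \subset base I by apply: (sB (Z, D, g)); rewrite mem_head.
have wE : stack_weight ((Z, D, g) :: stk) = weight g + stack_weight stk.
  by rewrite /stack_weight big_cons.
have wg : 0 < weight g by case: g {H sB wE lem h13}.
rewrite wE in lem *.
apply: (runs_while_step (b2 := (weight g + stack_weight stk) * (body_cost n + 10))
  _ (runs_body H IM sZ)); first by rewrite /= h13.
  move=> s1 [M1 [f1 [c1 [IM1]]]]; case: ifP => acc H1.
    have [_ _ _ g13 [g14 _]] := H1.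
    apply: runs_while_end; [by rewrite /= g13|rewrite /=; nia|].
    by exists (Some (attempt I Z)) => //; exact: attempt_correct.
  (* A rejected node lowers the total weight by exactly one: with budget left, three subtrees of
     weight [weight g'] replace one of weight [(3 * weight g').+1], and a node without budget has
     weight 1. *)
  have wp : (stack_weight (pushed Z D g stk)).+1 = weight g + stack_weight stk.
    rewrite /pushed; case: g {H sB wE lem h13 wg H1} => [|g] //=.
    by rewrite /stack_weight !big_cons /=; lia.
  apply: (runs_weaken (IH _ _ _ _ _ _ H1 IM1 _)).
  - by lia.
  - move=> e; rewrite /pushed; case: g {H wE lem h13 wg H1 wp} sB => [|g] sB.
      by move=> es; apply: sB; rewrite inE es orbT.
    rewrite mem_cat => /orP[|es]; last by apply: sB; rewrite inE es orbT.
    by rewrite !inE => /or3P[] /eqP-> //=; rewrite !subUset sZ lend_sub rend_sub.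
  - by rewrite wp.
  - move=> s2 [r h r_ok]; exists r => //; case: r h r_ok => // _ r_ok T tT kT e.
    rewrite inE => /orP[/eqP-> P|es]; last first.
      apply: (r_ok T tT kT); rewrite /pushed; case: (g) => // g'.
      by rewrite mem_cat es orbT.
    have [g' gE [e' e'c]] := promising_step PR tT kT (negbT acc) P.
    apply: (r_ok T tT kT); rewrite gE /pushed.
    by rewrite mem_cat e'c.
rewrite [ecost _]/= mulSn; lia.
Qed.
End Machine.

Lemma runs_assign_seq x e c s b P :
  runs c (update s x (eval s e)) b P ->
  runs (CSeq (CAssign x e) c) s ((ecost e).+1 + b) P.
Proof.
move=> H; apply: (runs_seq (Q := eq (update s x (eval s e))) _ _ (leqnn _)).
  exact: runs_assign.
by move=> _ <-.
Qed.

Lemma sem_empty n (G : sgraph n) M V : sem G M V TEmpty = set0.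
Proof. by apply/setP => i; rewrite semE !inE semE ltnn. Qed.

(** A negative bound demands no more than 0 does, so the program can work with a natural number. *)
Definition threshold (z : int) : nat := if (z < 0)%R then 0 else `|z|%N.

Lemma at_leastE n (A : {set 'I_n}) z : at_least A z <-> threshold z <= #|A|.
Proof. by rewrite /at_least /threshold; case: ifP; lia. Qed.

(** [W] bounds the number of tests of the search loop. It is the only exponential quantity, and the
    total cost is affine in it. *)
Definition search_cost n W :=
  (cost TForced n + 2) + ((cost TSat n + 2) + (2 + ((20 * n + 10) + (2 +
  ((cost TEmpty n + 2) + (8 + (W * (body_cost n + 10) + 2))))))).

Definition solve_cost n W :=
  4 + (2 + (2 + (2 + (2 + (2 + (2 + (2 + (2 + (5 + ((cost TBase n + 2) + ((cost TU n + 2) +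
  (cost TNoPair n + ((search_cost n W + 2) + 2))))))))))))).

Definition main_cost n W := 3 + (20 + (solve_cost n W + 20)).

(** * The whole program and the time bound *)

Section Main.
Variables (n : nat) (I : instance n) (v0 : 'I_n).
Hypotheses (v00 : v0 = 0 :> nat) (PR : path_restricted I).
Notation k := (threshold (par I)).

Lemma search_correct f r : k <= #|sat I (forced I)| + f ->
  search_result I k [:: (forced I, set0, f)] r -> correct_answer I r.
Proof.
move=> kf; case: r => [A [m sA kA]|H] /=; first by split=> //; apply/at_leastE.
case/yesP=> T tT /at_leastE kT.
apply: (H T tT kT (forced I, set0, f)); first by rewrite mem_head.
split=> /=; [exact: forced_sub|exact: sub0set|by rewrite cards0 addn0].
Qed.

(** By [good_sat] the potential starts at the number of good vertices or above, so the initial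
    budget is at most [k - g], truncated at 0. *)
Lemma fuel_le_excess : (forall s, s \in inS I -> two_linked (gr I) (base I) (base I) s) ->
  k - #|sat I (forced I)| <= excess I.
Proof.
move=> H; have := subset_leq_card (good_sat H); rewrite /excess /threshold.
move: #|good I| #|sat I _| => g m gm; case: ifP; lia.
Qed.

Lemma runs_search M c s :
  holds I M k 0 c [::] Leaf s -> input_sets I M ->
  (forall s, s \in inS I -> two_linked (gr I) (base I) (base I) s) ->
  runs run_search s (search_cost n (2 * 3 ^ excess I))
    (fun s' => exists2 r, s' 0 = enc_answer r & correct_answer I r).
Proof.
move=> H IM HP; have [M0 M1 M4 M5] := IM; rewrite /search_cost.
apply: runs_seq (runs_set v00 TForced _ H) _ (leqnn _) => // {H} s1.
rewrite sem_forced // => H.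
have fB : forced I \subset base I.
  by apply/subsetP => u; rewrite in_set baseE => /andP[uU _]; rewrite in_setU uU orbT.
apply: runs_seq (runs_set v00 TSat _ H) _ (leqnn _) => // {H} s2.
rewrite sem_sat // => H.
apply: (runs_seq (b1 := 2) (Q := holds I (upd (upd M 2 (forced I)) 6 (sat I (forced I)))
   k 0 k [::] Leaf) _ _ (leqnn _)).
  by apply: runs_assign => //=; apply: (holds_count H); case: H => _ _ [].
move=> {H} s3 H; apply: runs_seq (runs_count 6 H) _ (leqnn _) => {H} s4 H.
set f := k - #|sat I (forced I)|.
apply: (runs_seq (b1 := 2) (Q := holds I (upd (upd M 2 (forced I)) 6 (sat I (forced I)))
   k f f [::] Leaf) _ _ (leqnn _)).
  by apply: runs_assign => //=; apply: (holds_fuel H); case: H => _ _ [].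
move=> {H} s5 H; apply: runs_seq (runs_set v00 TEmpty _ H) _ (leqnn _) => // {H} s6.
rewrite sem_empty => H.
apply: runs_seq (runs_push _ _ H) _ (leqnn _) => {H} s7 H.
apply: (runs_seq (b1 := 2 * 3 ^ excess I * (body_cost n + 10)) (b2 := 2) (Q := fun s' =>
   exists2 r, s' 14 = enc_answer r & correct_answer I r)) => //.
  apply: runs_weaken (runs_loop v00 PR H _ _) _ _ => //.
  - by move=> e; rewrite inE => /eqP->.
  - apply: leq_mul => //; rewrite /stack_weight big_seq1.
    apply: leq_trans (weight_le _) _; rewrite leq_mul2l leq_pexp2l //.
    exact: fuel_le_excess.
  - move=> s8 [r h R]; exists r => //; apply: search_correct R.
    rewrite /f; lia.
by move=> s8 [r h C]; apply: runs_assign => //; exists r.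
Qed.

Lemma runs_solve s : s 0 = enc_instance I -> s 1 = enc_graph (gr I) ->
  s 11 = enc_nat k -> (forall x, 11 < x -> s x = Leaf) ->
  runs run_solve s (solve_cost n (2 * 3 ^ excess I))
    (fun s' => exists2 r, s' 0 = enc_answer r & correct_answer I r).
Proof.
move=> s_0 s_1 s_11 sx.
pose M := upd (fun=> inS I) 1 (inF I).
rewrite /solve_cost; do 10!apply: runs_assign_seq.
set s1 := update _ 3 _.
have H : holds I M k 0 0 [::] Leaf s1.
  have hS : hd_tree (tl_tree (s 0)) = enc_set (inS I) by rewrite s_0.
  have hF : hd_tree (tl_tree (tl_tree (s 0))) = enc_set (inF I) by rewrite s_0.
  split; first [exact: s_1 | by split; [exact: s_11|exact: sx|exact: sx] | exact: sx
    | by split; exact: sx | idtac].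
  move=> X; rewrite /reg; case: ifP => [|X9].
    by do 9!(case: X => [_|X]; first by [exact: hS|exact: hF]).
  by rewrite /M /upd; case: eqP X9 => [->//|_ _]; exact: hS.
move: s1 H => {s s_0 s_1 s_11 sx} s H.
apply: runs_seq (runs_set v00 TBase _ H) _ (leqnn _) => // {H} s1; rewrite sem_base // => H.
apply: runs_seq (runs_set v00 TU _ H) _ (leqnn _) => // {H} s2; rewrite sem_U // => H.
apply: (runs_test v00 H) => {H} s3 H; rewrite sem_nopair //; case: ifP => HP.
  apply: runs_assign => /=; first by lia.
  (* A solution would give every vertex of [S] a linked pair of neighbours inside [T], hence inside
     [B]. *)
  exists None => // /yesP[T tT _]; case/existsP: HP => x /andP[xS].
  have [_ _ TB] := tT; case/negP.
  exact: (two_linked_sub TB TB (target_two_linked tT xS)).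
apply: runs_weaken (runs_search H _ _) _ _ => //; last by lia.
move=> x xS; move/negbT: HP; rewrite negb_exists => /forallP/(_ x).
by rewrite xS negbK.
Qed.

Lemma runs_main_pos : runs run_main (update (fun=> Leaf) 0 (enc_instance I))
   (main_cost n (2 * 3 ^ excess I))
    (fun s' => exists2 r, s' 0 = enc_answer r & correct_answer I r).
Proof.
rewrite /main_cost; apply: runs_assign_seq; set s := update _ 1 _.
pose P s1 := [/\ s1 0 = enc_instance I, s1 1 = enc_graph (gr I),
   s1 11 = enc_nat k & forall x, 11 < x -> s1 x = Leaf].
apply: (runs_seq (b1 := 20) (Q := P) _ _ (leqnn _)).
  have upd11 v : v = enc_nat k -> P (update s 11 v).
    move=> ->; split=> // x x11; rewrite update_gt // /s update_gt; last by lia.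
    by rewrite update_gt //; lia.
  apply: (runs_if (b := 10)) => //=; rewrite is_node_bool.
  case: ifP => z0; apply: runs_assign => //=; apply: upd11;
    by rewrite /threshold z0.
move=> s1 [h0 h1 h11 hx]; apply: (runs_if (b := solve_cost n (2 * 3 ^ excess I))); last first.
  by rewrite /=; lia.
rewrite /= h1 /enc_graph enc_seq_node size_map size_enum_ord.
by rewrite (leq_trans _ (ltn_ord v0)) //; exact: runs_solve.
Qed.
End Main.

(** Without vertices the empty set is the only candidate, and it is a solution exactly when the
    threshold is 0. *)
Lemma runs_main_zero (I : instance 0) :
  runs run_main (update (fun=> Leaf) 0 (enc_instance I)) (main_cost 0 (2 * 3 ^ excess I))
    (fun s' => exists2 r, s' 0 = enc_answer r & correct_answer I r).
Proof.
rewrite /main_cost; apply: runs_assign_seq; set s := update _ 1 _.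
have gE : enc_graph (gr I) = Leaf by rewrite /enc_graph enum_ord0.
apply: (runs_seq (b1 := 20) (Q := fun s1 => s1 1 = Leaf /\ s1 11 = enc_nat (threshold (par I)))
  _ _ (leqnn _)).
  apply: (runs_if (b := 10)) => //=; rewrite is_node_bool.
  by case: ifP => z0; apply: runs_assign => //=; rewrite /threshold z0; split=> //; exact: gE.
move=> s1 [h1 h11]; apply: (runs_if (b := 10)); last by rewrite /=; lia.
rewrite /= h1 /=; apply: (runs_if (b := 4)) => //=; rewrite h11 enc_nat_node.
case: ifP => k0; apply: runs_assign => //=.
  exists None => // -[A [_ /at_leastE kA _ _]].
  by have := leq_trans k0 kA; rewrite ltnNge (leq_trans (max_card _)) // card_ord.
exists (Some set0); first by rewrite /= /enc_set enum_ord0.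
split; last by apply/at_leastE; move/negbT: k0; rewrite -leqNgt leqn0 => /eqP->.
  split=> [[[|x c] []//]|Y]; first by have := ltn_ord x.
  by rewrite properE subset0 => /andP[/eqP->]; rewrite sub0set.
exact: sub0set.
Qed.

Lemma runs_main n (I : instance n) : path_restricted I ->
  runs run_main (update (fun=> Leaf) 0 (enc_instance I)) (main_cost n (2 * 3 ^ excess I))
    (fun s' => exists2 r, s' 0 = enc_answer r & correct_answer I r).
Proof.
case: n I => [|n] I PR; first exact: runs_main_zero.
exact: (@runs_main_pos _ I ord0).
Qed.

Lemma main_cost_le n W : 0 < W -> main_cost n W <= W * (main_cost n 0 + (body_cost n + 10)).
Proof.
move=> W0; have -> : main_cost n W = main_cost n 0 + W * (body_cost n + 10).
  by rewrite /main_cost /solve_cost /search_cost; lia.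
nia.
Qed.

Lemma poly_bounded_main : poly_bounded (fun n => main_cost n 0 + (body_cost n + 10)).
Proof.
rewrite /main_cost /solve_cost /search_cost /body_cost /next_cost.
by repeat first [exact: poly_bounded_const | exact: poly_bounded_id | exact: poly_bounded_cost
  | apply: poly_bounded_add | apply: poly_bounded_mul].
Qed.

Theorem theorem11 :
  exists (p : cmd) (a c : nat),
    forall (n : nat) (I : instance n), path_restricted I ->
      exists (r : option {set 'I_n}) (t : nat),
        [/\ computes_in p (enc_instance I) t (enc_answer r),
            correct_answer I r
          & t <= a * 3 ^ excess I * n.+1 ^ c].
Proof.
have [K HK] := poly_bounded_main.
(* One factor 2 comes from the bound on the weight of the search tree; [2 ^ K] comes from
   [n.+2 <= 2 * n.+1], as the polynomial bound has base [n.+2]. *)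
exists run_main, (2 * 2 ^ K), K => n I PR.
have [t [s [ex le [r s0 C]]]] := runs_main PR.
exists r, t; split=> //; first by exists s.
apply: leq_trans le _; apply: leq_trans (main_cost_le _ _) _.
  by rewrite muln_gt0 expn_gt0.
apply: (@leq_trans (2 * 3 ^ excess I * (2 * n.+1) ^ K)).
  rewrite leq_mul2l; apply/orP; right; apply: leq_trans (HK n) _.
  by case: (K) => // K'; rewrite leq_exp2r //; lia.
by rewrite expnMn mulnCA !mulnA [2 * 2 ^ K]mulnC.
Qed.
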